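(* Fix a prime number $p$. Let $\mathcal{Z}[p^\infty]$ be the family of finite abelian $p$-groups and let $X\in\mathcal{A}\mathcal{Z}[p^\infty]$ be a finitely generated object. Then the restriction of $X$ to $\mathcal{A}\mathcal{C}[p^\infty]$, and the restriction of $X$ to $\mathcal{A}\mathcal{F}[p^n]$ for each $n\ge 1$, is generated in finite degree and eventually torsion-free. Moreover, $X$ satisfies central stability.
   Context: Fix a field $k$ of characteristic zero. $\mathcal{G}$ is the category whose objects are finite groups and whose morphisms are conjugacy classes of surjective group homomorphisms. A subcategory of $\mathcal{G}$ always means a full and replete subcategory. For $\mathcal{U}\le\mathcal{G}$, $\mathcal{A}\mathcal{U}=[\mathcal{U}^{\mathrm{op}},\mathrm{Vect}_k]$; for $X\in\mathcal{A}\mathcal{U}$ and $\alpha\in\mathcal{U}(B,A)$ we write $\alpha^*\colon X(A)\to X(B)$ for the induced map. For $G\in\mathcal{U}$, $e_G(T)=k[\mathcal{U}(T,G)]$; $X$ is finitely generated if there is an epimorphism $\bigoplus_{i=1}^n e_{G_i}\to X$ for some finite list $G_1,\dots,G_n\in\mathcal{U}$. $\mathcal{C}[p^\infty]$ is the family of finite cyclic $p$-groups, and $\mathcal{F}[p^n]$ is the family of groups isomorphic to $(\mathbb{Z}/p^n)^r$ for some $r\ge 0$ (the finitely generated free $\mathbb{Z}/p^n$-modules). Both are full subcategories of $\mathcal{Z}[p^\infty]$, and restriction means precomposition with the inclusion. Let $\mathcal{U}$ be $\mathcal{C}[p^\infty]$ or $\mathcal{F}[p^n]$ and $Y\in\mathcal{A}\mathcal{U}$.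 - $Y$ is eventually torsion-free if there exists $r_0\in\mathbb{N}$ such that for every morphism $\alpha\colon B\to A$ in $\mathcal{U}$ with $|A|\ge r_0$, the map $\alpha^*\colon Y(A)\to Y(B)$ is injective. - $Y$ is generated in finite degree if there exists $r_0\in\mathbb{N}$ such that the canonical map $Y(A)\otimes k[\mathcal{U}(B,A)]\to Y(B)$, $(x,\alpha)\mapsto\alpha^*(x)$, is surjective for all $A,B\in\mathcal{U}$ with $|B|\ge|A|\ge r_0$. An object $X\in\mathcal{A}\mathcal{Z}[p^\infty]$ satisfies central stability if there exists $n\in\mathbb{N}$ such that for all $G\in\mathcal{Z}[p^\infty]$ the canonical map $\varinjlim_{H\in N(G,n)}X(G/H)\to X(G)$ is an isomorphism, where $N(G,n)=\{H\triangleleft G\mid |G/H|\le n\}$; here for $H\le H'$ the transition map $X(G/H')\to X(G/H)$ is induced by the projection $G/H\to G/H'$, and the maps to $X(G)$ are induced by the projections $G\to G/H$. *)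

(* Defs.v *)
From HB Require Import structures.
From mathcomp Require Import all_boot all_order all_algebra all_fingroup.
From mathcomp Require Import all_solvable.

Set Implicit Arguments.
Unset Strict Implicit.
Unset Printing Implicit Defensive.
Import GRing.Theory.
Local Open Scope group_scope.

(* A finite group is a finGroupType, i.e. the group is [set: G]. *)

Definition surj_hom (B A : finGroupType) (f : {ffun B -> A}) : bool :=
  morphic [set: B] f && (f @: [set: B] == [set: A]).

Definition conj_class (B A : finGroupType) (f : {ffun B -> A}) :
  {set {ffun B -> A}} := [set [ffun x => f x ^ a] | a in [set: A]].

(* Morphisms B -> A of the category of finite groups and conjugacy classes of
   surjective homomorphisms. *)
Definition hom (B A : finGroupType) : finType :=
  {C : {set {ffun B -> A}} | [exists f, surj_hom f && (C == conj_class f)]}.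

Section HomTheory.
Implicit Types A B C D : finGroupType.

Lemma surj_homP B A (f : {ffun B -> A}) :
  reflect ({morph f : x y / x * y} /\ forall a, exists b, f b = a) (surj_hom f).
Proof.
apply: (iffP andP) => [[/morphicP fM /eqP fS]|[fM fS]]; split.
- by move=> x y; apply: fM; rewrite inE.
- move=> a; have: a \in [set: A] by rewrite inE.
  by rewrite -fS => /imsetP[b _ ->]; exists b.
- by apply/morphicP => x y _ _; apply: fM.
- apply/eqP/setP => a; rewrite inE; apply/imsetP.
  by have [b <-] := fS a; exists b; rewrite ?inE.
Qed.

Definition hom_of B A (f : {ffun B -> A}) (fS : surj_hom f) : hom B A.
Proof.
by exists (conj_class f); apply/existsP; exists f; rewrite fS eqxx.
Defined.

Lemma homP B A (u : hom B A) :
  exists2 f : {ffun B -> A}, surj_hom f & val u = conj_class f.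
Proof. by have /existsP[f /andP[fS /eqP uE]] := valP u; exists f. Qed.

Lemma surj_hom_id A : surj_hom [ffun x : A => x].
Proof.
by apply/surj_homP; split=> [x y|a]; [rewrite !ffunE | exists a; rewrite ffunE].
Qed.

Definition id_hom A : hom A A := hom_of (surj_hom_id A).

Definition comp_set C B A (S : {set {ffun B -> A}}) (T : {set {ffun C -> B}}) :
  {set {ffun C -> A}} := 
  [set [ffun x => (f : {ffun B -> A}) ((g : {ffun C -> B}) x)]
    | f in S, g in T].

Lemma surj_hom_comp C B A (f : {ffun B -> A}) (g : {ffun C -> B}) :
  surj_hom f -> surj_hom g -> surj_hom [ffun x => f (g x)].
Proof.
move=> /surj_homP[fM fS] /surj_homP[gM gS]; apply/surj_homP; split.
  by move=> x y; rewrite !ffunE gM fM.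
by move=> a; have [b <-] := fS a; have [c <-] := gS b; exists c; rewrite ffunE.
Qed.

Lemma comp_setE C B A (f : {ffun B -> A}) (g : {ffun C -> B}) :
  surj_hom f -> comp_set (conj_class f) (conj_class g) =
    conj_class [ffun x => f (g x)].
Proof.
move=> /surj_homP[fM _].
have fJ x b : f (x ^ b) = f x ^ f b.
  by apply: (mulgI (f b)); rewrite -fM -!conjgC fM.
apply/setP => h; apply/imset2P/imsetP.
  case=> _ _ /imsetP[a _ ->] /imsetP[b _ ->] ->.
  exists (f b * a); rewrite ?inE //.
  by apply/ffunP => x; rewrite !ffunE fJ conjgM.
case=> a _ ->; exists [ffun x => f x ^ a] g.
- by apply/imsetP; exists a.
- by apply/imsetP; exists 1; rewrite ?inE //; apply/ffunP=> x; rewrite ffunE conjg1.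
- by apply/ffunP => x; rewrite !ffunE.
Qed.

Lemma comp_hom_subproof C B A (u : hom B A) (v : hom C B) :
  [exists f, surj_hom f && (comp_set (val u) (val v) == conj_class f)].
Proof.
have [f fS ->] := homP u; have [g gS ->] := homP v.
by apply/existsP; exists [ffun x => f (g x)]; rewrite surj_hom_comp ?comp_setE /=.
Qed.

(* The composite "u after v": the class of all f \o g, f in u, g in v. *)
Definition comp_hom C B A (u : hom B A) (v : hom C B) : hom C A :=
  exist _ (comp_set (val u) (val v)) (comp_hom_subproof u v).

Lemma comp_hom_of C B A (f : {ffun B -> A}) (g : {ffun C -> B})
    (fS : surj_hom f) (gS : surj_hom g) :
  comp_hom (hom_of fS) (hom_of gS) = hom_of (surj_hom_comp fS gS).
Proof. by apply/val_inj; rewrite /= comp_setE. Qed.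

Lemma hom_ofP B A (u : hom B A) :
  exists (f : {ffun B -> A}) (fS : surj_hom f), u = hom_of fS.
Proof. by have [f fS uE] := homP u; exists f, fS; apply: val_inj. Qed.

Lemma eq_hom_of B A (f g : {ffun B -> A}) (fS : surj_hom f) (gS : surj_hom g) :
  f =1 g -> hom_of fS = hom_of gS.
Proof. by move=> /ffunP fg; apply: val_inj; rewrite /= fg. Qed.

Lemma comp_homA D C B A (u : hom B A) (v : hom C B) (w : hom D C) :
  comp_hom u (comp_hom v w) = comp_hom (comp_hom u v) w.
Proof.
have [f [fS ->]] := hom_ofP u; have [g [gS ->]] := hom_ofP v.
have [h [hS ->]] := hom_ofP w; rewrite !comp_hom_of.
by apply: eq_hom_of => x; rewrite !ffunE.
Qed.

Lemma comp_idhom B A (u : hom B A) : comp_hom (id_hom A) u = u.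
Proof.
have [f [fS ->]] := hom_ofP u; rewrite comp_hom_of.
by apply: eq_hom_of => x; rewrite !ffunE.
Qed.

Lemma comp_homid B A (u : hom B A) : comp_hom u (id_hom B) = u.
Proof.
have [f [fS ->]] := hom_ofP u; rewrite comp_hom_of.
by apply: eq_hom_of => x; rewrite !ffunE.
Qed.

End HomTheory.

(* A full and replete subcategory is determined by its class of objects. *)
Record family := Family {
  in_family :> finGroupType -> Prop;
  family_replete : forall G H : finGroupType,
    in_family G -> [set: G] \isog [set: H] -> in_family H }.

Record obj (U : family) := Obj {
  obj_group :> finGroupType;
  obj_in : U obj_group }.

Section Families.
Variables p n : nat.

Lemma Zfam_replete (G H : finGroupType) :
  p.-group [set: G] && abelian [set: G] -> [set: G] \isog [set: H] ->
  p.-group [set: H] && abelian [set: H].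
Proof.
move=> /andP[pG cG] iGH.
by rewrite -(isog_abelian iGH) cG /pgroup -(card_isog iGH) andbT.
Qed.

Definition Zfam : family :=
  @Family (fun G => p.-group [set: G] && abelian [set: G]) Zfam_replete.

Lemma Cfam_replete (G H : finGroupType) :
  p.-group [set: G] && cyclic [set: G] -> [set: G] \isog [set: H] ->
  p.-group [set: H] && cyclic [set: H].
Proof.
move=> /andP[pG cG] iGH.
by rewrite -(isog_cyclic iGH) cG /pgroup -(card_isog iGH) andbT.
Qed.

Definition Cfam : family :=
  @Family (fun G => p.-group [set: G] && cyclic [set: G]) Cfam_replete.

Lemma Ffam_replete (G H : finGroupType) :
  (exists r : nat, [set: G] \isog [set: 'rV['Z_(p ^ n)]_r]) ->
  [set: G] \isog [set: H] ->
  exists r : nat, [set: H] \isog [set: 'rV['Z_(p ^ n)]_r].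
Proof.
move=> [r iG] iGH; exists r; apply: isog_trans iG.
by rewrite isog_sym.
Qed.

(* Groups isomorphic to (Z/p^n)^r; only meaningful when 1 < p ^ n, since
   'Z_m denotes Z/2 for m <= 1. *)
Definition Ffam : family :=
  @Family (fun G => exists r : nat, [set: G] \isog [set: 'rV['Z_(p ^ n)]_r])
    Ffam_replete.

Lemma Cfam_Zfam (G : finGroupType) : Cfam G -> Zfam G.
Proof. by case/andP=> pG cG; apply/andP; split=> //; apply: cyclic_abelian. Qed.

Lemma Ffam_Zfam (p_pr : prime p) (n_gt0 : 0 < n) (G : finGroupType) :
  Ffam G -> Zfam G.
Proof.
case=> r iG; rewrite /= /pgroup (card_isog iG) (isog_abelian iG).
rewrite FinRing.zmod_abelian andbT cardsT card_mx card_ord.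
rewrite Zp_cast ?mul1n; last by rewrite -(exp1n n) ltn_exp2r ?prime_gt1.
by rewrite -expnM pnatX pnat_id.
Qed.

End Families.

Local Open Scope ring_scope.

Section Presheaves.
Variables (k : fieldType) (U : family).

(* Contravariant functors from U to vector spaces over k. *)
Record presheaf := Presheaf {
  psh_obj :> obj U -> lmodType k;
  psh_map : forall B A : obj U, hom B A -> {linear psh_obj A -> psh_obj B};
  psh_map_id : forall A : obj U, psh_map (id_hom A) =1 id;
  psh_map_comp : forall (C B A : obj U) (u : hom B A) (v : hom C B),
    psh_map (comp_hom u v) =1 psh_map v \o psh_map u }.

Record nat_trans (X Y : presheaf) := NatTrans {
  nat_app :> forall T : obj U, {linear X T -> Y T};
  nat_appP : forall (B A : obj U) (u : hom B A) (x : X A),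
    nat_app B (psh_map X u x) = psh_map Y u (nat_app A x) }.

Definition epimorphism (X Y : presheaf) (phi : nat_trans X Y) : Prop :=
  forall (Z : presheaf) (f g : nat_trans Y Z),
    (forall T x, f T (phi T x) = g T (phi T x)) -> forall T y, f T y = g T y.

Definition zero_map (A B : obj U) (x : 'rV[k]_0) : 'rV[k]_0 := x.
Arguments zero_map : clear implicits.

Lemma zero_map_linear A B : linear (zero_map A B).
Proof. by []. Qed.
HB.instance Definition _ A B :=
  GRing.isLinear.Build k 'rV[k]_0 'rV[k]_0 _ (zero_map A B) (zero_map_linear A B).

Definition zero_psh : presheaf.
Proof.
exists (fun=> 'rV[k]_0 : lmodType k) (fun B A _ => zero_map A B) => //.
Defined.

Section DirectSum.
Variables X Y : presheaf.

Definition dsum_map (B A : obj U) (u : hom B A) (z : X A * Y A) : X B * Y B :=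
  (psh_map X u z.1, psh_map Y u z.2).

Lemma dsum_map_linear (B A : obj U) (u : hom B A) : linear (@dsum_map B A u).
Proof. by move=> a x y; rewrite /dsum_map /= !linearP. Qed.
HB.instance Definition _ (B A : obj U) (u : hom B A) :=
  GRing.isLinear.Build k (X A * Y A)%type (X B * Y B)%type _ (@dsum_map B A u)
    (dsum_map_linear u).

Definition dsum : presheaf.
Proof.
exists (fun T => (X T * Y T)%type : lmodType k) (fun B A u => @dsum_map B A u).
- by move=> A [x y]; rewrite /= /dsum_map /= !psh_map_id.
- by move=> C B A u v [x y]; rewrite /= /dsum_map /= !psh_map_comp.
Defined.

End DirectSum.

(* k[S] for a finite set S. *)
Definition free_mod (S : finType) : lmodType k := {ffun S -> k^o}.

Definition basis_elt (S : finType) (s : S) : free_mod S :=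
  [ffun t => (t == s)%:R : k^o].

Definition free_map (S S' : finType) (f : S -> S') (c : free_mod S) :
  free_mod S' := [ffun t => \sum_(s | f s == t) c s].

Lemma free_map_linear (S S' : finType) (f : S -> S') : linear (free_map f).
Proof.
move=> a c d; apply/ffunP => t; rewrite !ffunE scaler_sumr -big_split /=.
by apply: eq_bigr => s _; rewrite !ffunE.
Qed.
HB.instance Definition _ (S S' : finType) (f : S -> S') :=
  GRing.isLinear.Build k (free_mod S) (free_mod S') _ (free_map f)
    (free_map_linear f).

Lemma free_map_basis (S S' : finType) (f : S -> S') s :
  free_map f (basis_elt s) = basis_elt (f s).
Proof.
apply/ffunP => t; rewrite !ffunE.
rewrite (eq_bigr (fun s' => if s' == s then 1 : k^o else 0)); last first.
  by move=> s' _; rewrite ffunE; case: eqP.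
rewrite -big_mkcondr /= eq_sym; have [fs|fs] := eqVneq (f s) t.
  rewrite (big_pred1 s) // => s' /=.
  by apply: andb_idl => /eqP->; rewrite fs.
by rewrite big1 // => s' /andP[/eqP fs' /eqP s's]; rewrite -fs' s's eqxx in fs.
Qed.

Lemma free_map_id (S : finType) (f : S -> S) : f =1 id -> free_map f =1 id.
Proof.
move=> fid c; apply/ffunP => t; rewrite ffunE (big_pred1 t) // => s /=.
by rewrite fid.
Qed.

Lemma free_map_comp (S S' S'' : finType) (f : S -> S') (g : S' -> S'') h :
  h =1 g \o f -> free_map h =1 free_map g \o free_map f.
Proof.
move=> hE c; apply/ffunP => t; rewrite /= !ffunE.
rewrite (partition_big f (fun s' => g s' == t)) /=; last first.
  by move=> s; rewrite hE.
apply: eq_bigr => s' /eqP gs'; rewrite ffunE; apply: eq_bigl => s.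
by rewrite hE /=; case: (f s =P s') => [->|]; rewrite ?gs' ?eqxx ?andbF.
Qed.

(* e_G(T) = k[U(T, G)], with u^* [a] = [a \o u]. *)
Definition e_psh (G : obj U) : presheaf.
Proof.
exists (fun T => free_mod (hom T G))
  (fun B A u => free_map (fun a : hom A G => comp_hom a u)).
- by move=> A; apply: free_map_id => a; apply: comp_homid.
- by move=> C B A u v; apply: free_map_comp => a; apply: comp_homA.
Defined.

(* The domain of phi is the direct sum of the e_G for G in Gs. *)
Definition finitely_generated (X : presheaf) : Prop :=
  exists (Gs : seq (obj U))
    (phi : nat_trans (foldr (fun G => dsum (e_psh G)) zero_psh Gs) X),
    epimorphism phi.

(* V (x) k[S] for a finite set S, with x (x) c = pure x c; this is justified by
   the universal property tensor_univ. *)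
Definition tensor (V : lmodType k) (S : finType) : lmodType k := {ffun S -> V}.

Definition pure (V : lmodType k) (S : finType) (x : V) (c : free_mod S) :
  tensor V S := [ffun s => c s *: x].

Lemma pure_linl (V : lmodType k) (S : finType) (c : free_mod S) : linear (fun x : V => pure x c).
Proof.
by move=> a x y; apply/ffunP => s; rewrite !ffunE scalerDr !scalerA mulrC.
Qed.

Lemma pure_linr (V : lmodType k) (S : finType) (x : V) : linear (@pure V S x).
Proof. by move=> a c d; apply/ffunP => s; rewrite !ffunE scalerDl scalerA. Qed.

Lemma free_mod_sum (S : finType) (c : free_mod S) :
  c = \sum_s (c s : k) *: basis_elt s.
Proof.
apply/ffunP => t; rewrite sum_ffunE (bigD1 t) //= !ffunE eqxx.
rewrite big1 ?addr0 => [|s st]; first by rewrite /GRing.scale /= mulr1.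
by rewrite !ffunE eq_sym (negPf st) scaler0.
Qed.

Lemma tensor_sum (V : lmodType k) (S : finType) (t : tensor V S) : t = \sum_s pure (t s) (basis_elt s).
Proof.
apply/ffunP => s; rewrite sum_ffunE (bigD1 s) //= !ffunE eqxx scale1r.
rewrite big1 ?addr0 // => s' ss'.
by rewrite !ffunE eq_sym (negPf ss') scale0r.
Qed.

Lemma tensor_univ (V W : lmodType k) (S : finType) (b : V -> free_mod S -> W) :
  (forall c, linear (b^~ c)) -> (forall x, linear (b x)) ->
  exists h : {linear tensor V S -> W}, (forall x c, h (pure x c) = b x c) /\
    forall h' : {linear tensor V S -> W},
      (forall x c, h' (pure x c) = b x c) -> h' =1 h.
Proof.
move=> bl br.
pose h (t : tensor V S) : W := \sum_s b (t s) (basis_elt s).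
have hlin : linear h.
  move=> a t t'; rewrite /h scaler_sumr -big_split /=.
  by apply: eq_bigr => s _; rewrite !ffunE bl.
pose hL := GRing.isLinear.Build k (tensor V S) W _ h hlin.
pose H : {linear tensor V S -> W} := HB.pack h hL.
have blZ c a x : b (a *: x) c = a *: b x c.
  pose f := GRing.isLinear.Build k V W _ (b^~ c) (bl c).
  pose F : {linear V -> W} := HB.pack (b^~ c) f.
  exact: (linearZZ F).
exists H; split=> [x c|h' h'P t].
  rewrite [c in RHS]free_mod_sum.
  pose f := GRing.isLinear.Build k (free_mod S) W _ (b x) (br x).
  pose F : {linear free_mod S -> W} := HB.pack (b x) f.
  rewrite -[RHS]/(F _) linear_sum /=; apply: eq_bigr => s _.
  by rewrite ffunE blZ -[RHS]/(F _) (linearZZ F).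
rewrite [t in LHS]tensor_sum linear_sum.
by apply: eq_bigr => s _; rewrite h'P.
Qed.

(* The canonical map Y(A) (x) k[U(B, A)] -> Y(B). *)
Definition act (Y : presheaf) (A B : obj U) (t : tensor (Y A) (hom B A)) : Y B :=
  \sum_(u : hom B A) psh_map Y u (t u).

Lemma act_linear (Y : presheaf) (A B : obj U) : linear (@act Y A B).
Proof.
move=> a t t'; rewrite /act scaler_sumr -big_split /=.
by apply: eq_bigr => s _; rewrite !ffunE linearP.
Qed.

Lemma act_pure (Y : presheaf) (A B : obj U) (x : Y A) (u : hom B A) :
  act (pure x (basis_elt u)) = psh_map Y u x.
Proof.
rewrite /act (bigD1 u) //= !ffunE eqxx scale1r big1 ?addr0 // => v vu.
by rewrite !ffunE (negPf vu) scale0r linear0.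
Qed.

Definition generated_in_finite_degree (Y : presheaf) : Prop :=
  exists r0 : nat, forall A B : obj U, (r0 <= #|A| <= #|B|)%N ->
    forall y : Y B, exists t : tensor (Y A) (hom B A), act t = y.

Definition eventually_torsion_free (Y : presheaf) : Prop :=
  exists r0 : nat, forall (B A : obj U) (u : hom B A), (r0 <= #|A|)%N ->
    injective (psh_map Y u).

End Presheaves.

Section Restriction.
Variables (k : fieldType) (U V : family) (UV : forall G, U G -> V G).

Definition incl (A : obj U) : obj V := Obj (UV (obj_in A)).

Definition restrict (X : presheaf k V) : presheaf k U.
Proof.
exists (fun A => X (incl A)) (fun B A u => @psh_map k V X (incl B) (incl A) u).
- by move=> A x; exact: (@psh_map_id k V X (incl A) x).
- move=> C B A u v.
  exact: (@psh_map_comp k V X (incl C) (incl B) (incl A) u v).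
Defined.

End Restriction.

Section CentralStability.
Variables (k : fieldType) (p : nat).
Local Notation Z := (Zfam p).

Definition Nsub (G : finGroupType) (n : nat) : finType :=
  {H : {group G} | (H <| [set: G]) && (#|[set: G] / H|%g <= n)%N}.

Lemma Nsub_normal G n (H : Nsub G n) : val H <| [set: G].
Proof. by case/andP: (valP H). Qed.

Lemma quotientT (G : finGroupType) (H : {group G}) :
  H <| [set: G] -> [set: coset_of H] = ([set: G] / H)%g.
Proof.
move=> /andP[_ nH]; apply/setP => u; rewrite inE; symmetry.
by case: (cosetP u) => x _ ->; rewrite mem_quotient ?inE.
Qed.

Lemma coset_surj (G : finGroupType) (H : {group G}) :
  H <| [set: G] -> surj_hom [ffun x => coset H x].
Proof.
move=> /andP[_ /subsetP nH]; apply/surj_homP; split=> [x y|u].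
  by rewrite !ffunE morphM ?nH ?inE.
by case: (cosetP u) => x _ ->; exists x; rewrite ffunE.
Qed.

Lemma cosets_surj (G : finGroupType) (H H' : {group G}) :
  H <| [set: G] -> H' <| [set: G] -> H \subset H' ->
  surj_hom [ffun u : coset_of H => coset H' (repr u)].
Proof.
move=> /andP[_ /subsetP nH] /andP[_ /subsetP nH'] sHH'.
have reprE x : coset H' (repr (coset H x)) = coset H' x.
  rewrite val_coset ?nH ?inE //; case: repr_rcosetP => h Hh.
  by rewrite mkerl // ?ker_coset ?(subsetP sHH') ?nH' ?inE.
apply/surj_homP; split=> [u v|w].
  case: (cosetP u) => x Nx ->; case: (cosetP v) => y Ny ->.
  by rewrite -morphM // !ffunE !reprE morphM ?nH' ?inE.
by case: (cosetP w) => x _ ->; exists (coset H x); rewrite ffunE reprE.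
Qed.

Lemma quot_in (G : obj Z) (H : {group G}) :
  H <| [set: G] -> Z (coset_of H : finGroupType).
Proof.
move=> nH; have /andP[pG cG] := obj_in G.
by rewrite /= quotientT // quotient_pgroup ?quotient_abelian.
Qed.

Definition quot (G : obj Z) n (H : Nsub G n) : obj Z :=
  Obj (quot_in (Nsub_normal H)).

Definition proj (G : obj Z) n (H : Nsub G n) : hom G (quot H) :=
  hom_of (coset_surj (Nsub_normal H)).

Definition proj2 (G : obj Z) n (H H' : Nsub G n) (sHH' : val H \subset val H') :
  hom (quot H) (quot H') :=
  hom_of (cosets_surj (Nsub_normal H) (Nsub_normal H') sHH').

Variable X : presheaf k Z.

Record cocone (G : obj Z) (n : nat) (L : lmodType k) := Cocone {
  leg :> forall H : Nsub G n, {linear X (quot H) -> L};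
  legP : forall (H H' : Nsub G n) (sHH' : val H \subset val H')
    (x : X (quot H')), leg H (psh_map X (proj2 sHH') x) = leg H' x }.

Definition is_colimit G n (L : lmodType k) (c : cocone G n L) : Prop :=
  forall (W : lmodType k) (d : cocone G n W),
    exists h : {linear L -> W}, (forall H x, h (c H x) = d H x) /\
      forall h' : {linear L -> W}, (forall H x, h' (c H x) = d H x) -> h' =1 h.

(* The canonical map h is the one induced by the projections G -> G/H. *)
Definition central_stability : Prop :=
  exists n : nat, forall G : obj Z,
    exists (L : lmodType k) (c : cocone G n L) (h : {linear L -> X G}),
      [/\ is_colimit c, forall H x, h (c H x) = psh_map X (proj H) x
        & bijective h].

End CentralStability.

(* Main.v *)
Require Import Defs.
From HB Require Import structures.
From mathcomp Require Import all_boot all_order all_algebra all_fingroup.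
From mathcomp Require Import all_solvable.
From Stdlib Require Import ClassicalEpsilon.

Set Implicit Arguments.
Unset Strict Implicit.
Unset Printing Implicit Defensive.
Import Defs GRing.Theory.

(** Everything rests on one noetherianity statement, proved with Groebner bases.
    Let X be generated by finitely many elements x_i in X(G_i). Then X(T) is a
    quotient, by [ev], of the vector space k[S(T)] on the finite set S(T) of
    pairs of an index i and a surjection T -> G_i ([surjs]). The claim is that an
    increasing sequence of subpresheaves of k[S] is stationary
    ([chain_condition], [chain_stable]), on the whole category of finite abelian
    p-groups and equally on any full subcategory of it.

    To see this, choose in each T a decomposition into cyclic groups, listed by
    increasing order. A surjection T -> G_i becomes a word: the images of the
    chosen generators, each labelled by the order of the generator. If the word of
    s' in S(T') arises from the word of s in S(T) by inserting letters that
    already occur earlier and by raising labels, then sending each generator of T'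
    to a suitable generator of T defines a surjection T' -> T which pulls s back
    to s'. Since a new letter is identified with one before it, this pullback is
    strictly increasing for the lexicographic order, hence maps leading terms to
    leading terms. Higman's lemma ([higman]), applied to words whose letters
    remember the set of preceding letters, shows that such a pair s, s' is found
    in every infinite sequence ([surjs_good_pair]), and the usual cancellation of
    leading terms turns this into the chain condition.

    The three conclusions follow.

    Torsion-freeness ([eventually_torsion_freeP]): let L_m(A) be the elements
    killed by all maps C -> A with |C| >= m. This chain is stationary, say from m
    on. If x in X(A) with |A| >= m is killed by one map B -> A, and every map
    C -> A with C large factors through B -> A, then x lies in some L_m', hence in
    L_m(A), and the identity of A kills it. The factorizations are [cyclic_lift]
    and [free_lift].

    Generation in finite degree ([generated_in_finite_degreeP]) reduces to
    factoring every surjection B -> G_i through A when A is large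
    ([cyclic_factor], [free_factor]). For free modules both kinds of
    factorization come from a basis of the source adapted to the surjection: all
    but boundedly many basis vectors can be taken in its kernel
    ([adapted_basis]).

    Central stability ([central_stabilityP]): the relations between the
    generators form a subpresheaf of k[S], which by the chain condition is
    generated by relations on groups of bounded order ([relations_bounded]). A
    compatible family of maps out of the X(G/H) with |G/H| bounded then prescribes
    the values of a linear map on the generators of X(G), each of which factors
    through a small quotient, and respects all relations, because each of them is
    pulled back from a small quotient too. *)

(** Boolean tests are what minimization over the natural numbers and the quotient
    by a subgroup take as input. *)
Definition asbool (P : Prop) : bool :=
  if excluded_middle_informative P then true else false.

Lemma asboolP P : reflect P (asbool P).
Proof. by rewrite /asbool; case: excluded_middle_informative => ?; constructor. Qed.

(** * Higman's lemma for words with natural labels *)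

Section Higman.
Variable L : finType.
Implicit Type w : seq (L * nat).

(** Higman's embedding order: w is obtained from w' by deleting letters and by
    lowering labels. *)
Fixpoint emb w w' : Prop :=
  match w' with
  | [::] => w = [::]
  | a' :: v' => emb w v' \/
      match w with
      | [::] => False
      | a :: v => [/\ a.1 = a'.1, a.2 <= a'.2 & emb v v']
      end
  end.

Lemma emb_nil w : emb [::] w.
Proof. by elim: w => //= a w IH; left. Qed.

(** Pick a letter occurring infinitely often; among its later occurrences,
    repeatedly pick one with the least label. *)
Lemma increasing_subseq (h : nat -> L * nat) :
  exists sg : nat -> nat, (forall i, sg i < sg i.+1) /\
    forall i j, i <= j -> (h (sg i)).1 = (h (sg j)).1 /\ (h (sg i)).2 <= (h (sg j)).2.
Proof.
have [a inf_a] : exists a, forall n, exists2 m, n <= m & (h m).1 = a.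
  apply: NNPP => noa.
  have fin a : exists n, forall m, n <= m -> (h m).1 != a.
    apply: NNPP => fa; apply: noa; exists a => n; apply: NNPP => nm; apply: fa.
    exists n => m le_nm; apply/eqP => hm; apply: nm; by exists m.
  pose N a := proj1_sig (constructive_indefinite_description _ (fin a)).
  have NP a m : N a <= m -> (h m).1 != a.
    exact: (proj2_sig (constructive_indefinite_description _ (fin a)) m).
  have := NP (h (\max_a N a)).1 (\max_a N a) (leq_bigmax _).
  by rewrite eqxx.
have pick n : exists m, [/\ n <= m, (h m).1 = a
    & forall m', n <= m' -> (h m').1 = a -> (h m).2 <= (h m').2].
  pose P l := asbool (exists2 m, n <= m & h m = (a, l)).
  have exP : exists l, P l.
    have [m nm hm] := inf_a n; exists (h m).2; apply/asboolP; exists m => //.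
    by rewrite -hm; case: (h m).
  case: (ex_minnP exP) => l /asboolP[m nm hm] lmin.
  exists m; split=> // [|m' nm' hm']; first by rewrite hm.
  rewrite hm; apply: lmin; apply/asboolP; exists m' => //.
  by rewrite -{}hm'; case: (h m').
pose f n := proj1_sig (constructive_indefinite_description _ (pick n)).
have fP n : [/\ n <= f n, (h (f n)).1 = a
    & forall m', n <= m' -> (h m').1 = a -> (h (f n)).2 <= (h m').2].
  exact: (proj2_sig (constructive_indefinite_description _ (pick n))).
pose sg := fix sg i := if i is i'.+1 then f (sg i').+1 else f 0.
have sg_lt i : sg i < sg i.+1 by case: (fP (sg i).+1).
have sg_a i : (h (sg i)).1 = a by case: i => [|i]; [case: (fP 0) | case: (fP (sg i).+1)].
exists sg; split=> // i j; elim: j => [|j IH]; first by rewrite leqn0 => /eqP->.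
rewrite leq_eqVlt => /orP[/eqP-> //|]; rewrite ltnS => /IH{IH}[_ le_ij].
rewrite !sg_a; split=> //; apply: leq_trans le_ij _.
case: j => [|j].
  case: (fP 0) => _ _ /(_ (sg 1) isT (sg_a 1)); exact.
case: (fP (sg j).+1) => le_f _ /(_ (sg j.+2) _ (sg_a j.+2)); apply.
exact: leq_trans le_f (ltnW (sg_lt j.+1)).
Qed.

Definition bad (f : nat -> seq (L * nat)) := forall i j, i < j -> ~ emb (f i) (f j).

(** The two lemmas below construct the minimal bad sequence of Nash-Williams: the
    n-th word is as short as possible among the bad sequences that share the
    first n words already chosen. *)
Lemma bad_min (f : nat -> seq (L * nat)) n : bad f ->
  exists g, [/\ bad g, forall i, i < n -> g i = f i &
    forall g', bad g' -> (forall i, i < n -> g' i = f i) ->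
      size (g n) <= size (g' n)].
Proof.
have [s] := ubnP (size (f n)); elim: s f => // s IH f; rewrite ltnS => fs fbad.
have [fmin|] := classic (forall g', bad g' -> (forall i, i < n -> g' i = f i) ->
      size (f n) <= size (g' n)); first by exists f.
case/not_all_ex_not => g ng; have [gbad ng'] := imply_to_and _ _ ng.
have [gf /negP] := imply_to_and _ _ ng'.
rewrite -ltnNge => lt_gf.
have [|g1 [g1bad g1g g1min]] := IH g _ gbad.
  exact: leq_trans lt_gf fs.
exists g1; split=> // [i lt_in|g' g'bad g'f]; first by rewrite g1g // gf.
by apply: g1min => // i lt_in; rewrite g'f // gf.
Qed.

Lemma min_bad (f : nat -> seq (L * nat)) : bad f ->
  exists m, bad m /\ forall n g, bad g -> (forall i, i < n -> g i = m i) ->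
    size (m n) <= size (g n).
Proof.
move=> fbad.
pose B := {g | bad g}.
have next (b : B) n : {c : B | (forall i, i < n -> sval c i = sval b i) /\
    forall g', bad g' -> (forall i, i < n -> g' i = sval b i) ->
      size (sval c n) <= size (g' n)}.
  apply: constructive_indefinite_description.
  have [g [gbad gb gmin]] := bad_min n (svalP b).
  by exists (exist _ g gbad).
pose F := fix F n : B :=
  if n is n'.+1 then sval (next (F n') n) else sval (next (exist _ f fbad) 0).
have Fstable n k i : i <= n -> sval (F (n + k)) i = sval (F n) i.
  elim: k => [|k IH] le_in; first by rewrite addn0.
  have [eqF _] := svalP (next (F (n + k)) (n + k).+1).
  by rewrite addnS /= eqF ?IH // ltnS (leq_trans le_in) ?leq_addr.
(* The n-th word never changes after step n, so the diagonal is well defined. *)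
pose m n := sval (F n) n.
have mE n i : i <= n -> sval (F n) i = m i.
  by move=> le_in; rewrite -(subnKC le_in) Fstable.
exists m; split=> [i j lt_ij|n g gbad gm].
  rewrite -(mE j j) // -(mE j i) ?(ltnW lt_ij) //; exact: (svalP (F j)).
case: n gm => [|n] gm; rewrite /m /=.
  by case: (svalP (next (exist _ f fbad) 0)) => _; apply.
case: (svalP (next (F n) n.+1)) => _; apply=> // i lt_in.
by rewrite gm // mE // -ltnS.
Qed.

Lemma emb_behead w w' : emb w (behead w') -> emb w w'.
Proof. by case: w' => //= a w'; left. Qed.

(** In a minimal bad sequence, cut the first letters off along a subsequence whose
    first letters increase. The result is still bad, and it contradicts
    minimality at the place of the first cut. *)
Theorem higman (f : nat -> seq (L * nat)) : exists i j, i < j /\ emb (f i) (f j).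
Proof.
apply: NNPP => nogood.
have fbad : bad f by move=> i j lt_ij fij; apply: nogood; exists i, j.
have [m [mbad mmin]] := min_bad fbad.
have m_cons n : exists a v, m n = a :: v.
  case mn: (m n) => [|a v]; last by exists a, v.
  by case: (mbad n n.+1 (ltnSn n)); rewrite mn; apply: emb_nil.
have [a0 _] := m_cons 0.
pose h n := head a0 (m n); pose t n := behead (m n).
have mht n : m n = h n :: t n by rewrite /h /t; have [a [v ->]] := m_cons n.
have [sg [sg_lt sgP]] := increasing_subseq h.
have sg_mono i j : i < j -> sg i < sg j.
  elim: j => // j IH; rewrite ltnS leq_eqVlt => /orP[/eqP-> //|/IH].
  by move=> lt_ij; apply: ltn_trans (sg_lt j).
pose n0 := sg 0.
pose g n := if n < n0 then m n else t (sg (n - n0)).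
have gbad : bad g.
  move=> i j lt_ij; rewrite /g; case: (ltnP j n0) => [lt_j|le_j].
    by rewrite (ltn_trans lt_ij lt_j); apply: mbad.
  case: (ltnP i n0) => [lt_i|le_i] hij.
    have lt_isg : i < sg (j - n0).
      case: (posnP (j - n0)) => [->//|/sg_mono]; exact: ltn_trans.
    by apply: (mbad _ _ lt_isg); apply: emb_behead.
  have lt_ij' : i - n0 < j - n0 by rewrite ltn_sub2r // (leq_ltn_trans le_i).
  apply: (mbad _ _ (sg_mono _ _ lt_ij')); rewrite !mht /=; right.
  by have [-> le_h] := sgP _ _ (ltnW lt_ij').
have := mmin n0 g gbad; rewrite {2}/g ltnn subnn -/n0 mht /= ltnn.
by move=> absurd; suff: false by []; apply: absurd => i; rewrite /g => ->.
Qed.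

End Higman.

(** * Substitutions of words *)

Section Words.
Variable T : finType.
Implicit Types (t : T) (E : {set T}) (w : seq (T * nat)) (ph : seq nat).

(** Each letter is decorated with the set E of letters that precede it, and an
    end marker carries the set of all letters. If decorated words embed, then a
    letter of the larger word that is left unmatched belongs to the set carried
    by the next matched letter, or by the end marker; so the same letter has
    been matched before. The end marker can only be matched with itself. *)
Fixpoint annot E w : seq ((option T * {set T}) * nat) :=
  match w with
  | [::] => [:: ((None, E), 0)]
  | a :: v => ((Some a.1, E), a.2) :: annot (a.1 |: E) v
  end.

(** [rgf 0 ph M] says that ph, read as a map from positions to [0, M), is onto,
    and that the values make their first appearances in increasing order (a
    restricted growth function). The parameter m is the number of values already
    seen. *)
Fixpoint rgf m ph M : bool :=
  match ph with
  | [::] => m == M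
  | j :: ph' => if j < m then rgf m ph' M else (j == m) && rgf m.+1 ph' M
  end.

Lemma rgf_mem m ph M j : rgf m ph M -> m <= j < M -> j \in ph.
Proof.
elim: ph m => [|i ph IH] m /=.
  by move/eqP=> ->; rewrite leqNgt; case: ltnP.
case: ltnP => [lt_im /IH{}IH /IH|le_mi /andP[/eqP-> /IH{}IH]].
  by rewrite in_cons orbC => ->.
by rewrite leq_eqVlt inE eq_sym => /andP[/orP[->//|lt_mj] lt_jM]; rewrite IH ?orbT ?lt_mj.
Qed.

Lemma rgf_lt m ph M : rgf m ph M -> (m <= M) && all (fun j => j < M) ph.
Proof.
elim: ph m => [|i ph IH] m /=; first by move/eqP->; rewrite leqnn.
case: ltnP => [lt_im /IH/andP[le_mM ->]|le_mi /andP[/eqP-> /IH/andP[lt_mM ->]]].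
  by rewrite le_mM (leq_trans lt_im le_mM).
by rewrite (ltnW lt_mM) lt_mM.
Qed.

Lemma annot_neq0 E w : exists a v, annot E w = a :: v /\ a.1.2 = E.
Proof. by case: w => [|a w] /=; do 2!eexists; split. Qed.

Lemma emb_annot_sub E w E' w' : emb (annot E w) (annot E' w') -> E' \subset E.
Proof.
have [a [v [-> <-]]] := annot_neq0 E w.
elim: w' E' => [|a' w' IH] E' /=.
  by case=> // -[->].
case=> [/IH|[->] //]; apply: subset_trans; exact: subsetUr.
Qed.

(** From an embedding of decorated words, a substitution ph that writes each
    letter of w' as a letter of w with a label not larger. Matched positions
    follow the embedding; an unmatched letter is sent to its first occurrence in
    the part u of w already consumed, whose labels are small enough because the
    labels of w' increase. *)
Lemma emb_annot t0 (u : seq (T * nat)) w w' (E E' : {set T}) :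
    E =i map fst u ->
    sorted leq (map snd w') ->
    all (fun a => all (fun b => a.2 <= b.2) w') u ->
    emb (annot E w) (annot E' w') ->
  exists ph, [/\ rgf (size u) ph (size u + size w),
    size ph = size w' &
    forall i, i < size ph ->
      (nth t0 (map fst (u ++ w)) (nth 0 ph i) = nth t0 (map fst w') i) /\
      nth 0 (map snd (u ++ w)) (nth 0 ph i) <= nth 0 (map snd w') i].
Proof.
elim: w' w u E E' => [|[t' l'] w' IH] w u E E' Eu srt uw'.
  case: w => [|a w] /=; last by case=> // -[].
  by move=> _; exists [::]; rewrite addn0 /= eqxx.
move=> /= [unm|].
  have t'E : t' \in E.
    by apply: (subsetP (emb_annot_sub unm)); rewrite !inE eqxx.
  have [||ph [rg sz phP]] := IH w u E _ Eu _ _ unm.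
  - exact: path_sorted srt.
  - by apply/allP => a /(allP uw') /=; case/andP.
  have t'u : t' \in map fst u by rewrite -Eu.
  set j := index t' (map fst u).
  have ltj : j < size u by rewrite -(size_map fst) index_mem.
  exists (j :: ph); split=> [||[|i]] /=.
  - by rewrite ltj.
  - by rewrite sz.
  - move=> _; rewrite map_cat nth_cat size_map ltj nth_index //.
    split=> //; rewrite map_cat nth_cat size_map ltj (nth_map (t0, 0)) //.
    by have := allP uw' _ (mem_nth (t0, 0) ltj); case/andP.
  - by rewrite ltnS => /phP.
case: w => [|[t l] w] /= [] // [] [tt'] EE' ll' mat; subst t' E'.
have [|||ph [rg sz phP]] := IH w (rcons u (t, l)) _ _ _ _ _ mat.
- by move=> x; rewrite !inE map_rcons mem_rcons inE Eu.
- exact: path_sorted srt.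
- rewrite all_rcons; apply/andP; split; last first.
    by apply/allP => a /(allP uw') /=; case/andP.
  have := order_path_min leq_trans srt.
  rewrite all_map => /allP h; apply/allP => b /h /=; exact: leq_trans.
rewrite size_rcons cat_rcons in rg phP.
exists (size u :: ph); split=> [||[|i]] /=.
- by rewrite ltnn eqxx /= addnS -addSn.
- by rewrite sz.
- by move=> _; rewrite !map_cat !nth_cat !size_map ltnn subnn.
- by rewrite ltnS => /phP.
Qed.

End Words.

Import Order.TTheory.

(** Substitution along a restricted growth function preserves the strict
    lexicographic order: if s and t first differ at j, then the substituted words
    agree before the first appearance of j in ph, as only smaller values occur
    there, and differ at that place in the same direction. For the induction, s
    and t are supposed to agree on the m values already seen. *)
Lemma lexi_rgf m ph M (s t s' t' : seq nat) :
    rgf m ph M -> size s = M -> size t = M ->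
    size s' = size ph -> size t' = size ph ->
    (forall i, i < size ph -> nth 0 s' i = nth 0 s (nth 0 ph i)) ->
    (forall i, i < size ph -> nth 0 t' i = nth 0 t (nth 0 ph i)) ->
    (forall j, j < m -> nth 0 s j = nth 0 t j) ->
    ((drop m s : seqlexi nat) < drop m t)%O -> ((s' : seqlexi nat) < t')%O.
Proof.
elim: ph m s' t' => [|i ph IH] m [|x s'] [|y t'] //=.
  move=> /eqP<- sz_s sz_t _ _ _ _ _; by rewrite !drop_oversize ?sz_s ?sz_t // ltxx.
move=> rg sz_s sz_t [sz_s'] [sz_t'] sP tP st lt_st.
have /= -> := sP 0 isT; have /= -> := tP 0 isT.
have {}sP j : j < size ph -> nth 0 s' j = nth 0 s (nth 0 ph j) by move/(sP j.+1).
have {}tP j : j < size ph -> nth 0 t' j = nth 0 t (nth 0 ph j) by move/(tP j.+1).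
rewrite ltxi_cons; move: rg; case: ltnP => [lt_im rg|_ /andP[/eqP-> rg]].
  by rewrite st // lexx /=; apply: IH rg _ _ _ _ _ _ _ _ .
have /andP[lt_mM _] := rgf_lt rg.
move: lt_st; rewrite (drop_nth 0) ?sz_s // (drop_nth 0 (s := t)) ?sz_t // ltxi_cons.
case/andP=> le_st /implyP lt_st; rewrite le_st; apply/implyP => le_ts.
have eq_m : nth 0 s m = nth 0 t m by apply/le_anti; rewrite le_st.
apply: IH rg _ _ _ _ _ _ _ (lt_st le_ts) => // j.
by rewrite ltnS leq_eqVlt => /orP[/eqP->|/st].
Qed.

(** * Leading terms and the ascending chain condition *)

(** An abstract setting: [pb u] is the pullback along u of a presheaf of finite
    sets S, and [key] totally orders each S A. *)
Section Groebner.
Local Open Scope ring_scope.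
Import Order.TTheory.
Variables (k : fieldType) (Ob : Type) (Mor : Ob -> Ob -> Type).
Variables (S : Ob -> finType) (pb : forall A B, Mor B A -> S A -> S B).
Variables (disp : Order.disp_t) (K : orderType disp) (key : forall A, S A -> K).
Hypothesis key_inj : forall A, injective (@key A).

Definition monotone A B (u : Mor B A) :=
  {homo pb u : s t / (key s < key t)%O}.

Hypothesis good_pair : forall (A : nat -> Ob) (s : forall m, S (A m)),
  exists i j, (i < j)%N /\
    exists2 u : Mor (A j) (A i), pb u (s i) = s j & monotone u.

Local Notation M A := (free_mod k (S A)).

Definition leading A (c : M A) s := c s != 0 /\ forall t, c t != 0 -> (key t <= key s)%O.

Lemma leadingP A (c : M A) : c = 0 \/ exists s, leading c s.
Proof.
have [c0|] := boolP [forall s, c s == 0].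
  by left; apply/ffunP => s; rewrite ffunE; apply/eqP/(forallP c0).
rewrite negb_forall => /existsP[s0 cs0]; right.
by case: (@arg_maxP _ _ _ s0 [pred s | c s != 0] (@key A) cs0) => s cs smax; exists s.
Qed.

Lemma free_map_inj A B (u : Mor B A) (c : M A) s :
  injective (pb u) -> free_map (pb u) c (pb u s) = c s.
Proof.
by move=> uI; rewrite ffunE (big_pred1 s) // => t /=; rewrite (inj_eq uI).
Qed.

Lemma monotone_inj A B (u : Mor B A) : monotone u -> injective (pb u).
Proof.
move=> um s t ust; apply: key_inj; apply/eqP.
by case: ltgtP => // /um; rewrite ust ltxx.
Qed.

Lemma leading_map A B (u : Mor B A) (c : M A) s :
  monotone u -> leading c s -> leading (free_map (pb u) c) (pb u s).
Proof.
move=> um [cs smax]; split; first by rewrite free_map_inj //; exact: monotone_inj.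
move=> t; rewrite ffunE => ut; have [s' us' cs'] : exists2 s', pb u s' = t & c s' != 0.
  apply: NNPP => no; case/negP: ut; apply/eqP/big1 => s' /eqP us'.
  by apply/eqP; apply: contraT => cs'; case: no; exists s'.
rewrite -us'; have := smax _ cs'; rewrite le_eqVlt => /orP[/eqP/key_inj->//|/um].
exact: ltW.
Qed.

Variable L : nat -> forall A, M A -> Prop.
Hypothesis L0 : forall m A, @L m A 0.
Hypothesis Llin : forall m A a (c d : M A), L m c -> L m d -> L m (c + a *: d).
Hypothesis Lpb : forall m A B (u : Mor B A) (c : M A), L m c -> L m (free_map (pb u) c).
Hypothesis Lmono : forall m A (c : M A), L m c -> L m.+1 c.

Lemma Lmono_le m m' A (c : M A) : (m <= m')%N -> L m c -> L m' c.
Proof. by move=> /subnK<-; elim: (m' - m)%N => // n IH /IH; rewrite addSn; exact: Lmono. Qed.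

(** Among the elements that separate L m from L m', one with least leading term. *)
Lemma leading_gap m m' A (c : M A) : L m' c -> ~ L m c ->
  exists (d : M A) s, [/\ L m' d, ~ L m d, leading d s &
    forall e : M A, L m' e -> (forall t, e t != 0 -> (key t < key s)%O) -> L m e].
Proof.
pose N (s : S A) := #|[pred t : S A | (key t < key s)%O]|.
move=> Lc Nc; have [c0|[s sc]] := leadingP c; first by case: Nc; rewrite c0.
have [n] := ubnP (N s); elim: n => // n IH in c s Lc Nc sc *; rewrite ltnS => le_n.
have [] := classic (forall e : M A, L m' e -> (forall t, e t != 0 -> (key t < key s)%O) -> L m e).
  by exists c, s.
case/not_all_ex_not => e ne; have [Le ne'] := imply_to_and _ _ ne.
have [et nLe] := imply_to_and _ _ ne'.
have [e0|[s' se]] := leadingP e; first by case: nLe; rewrite e0.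
apply: (IH e s') => //; apply: leq_trans le_n; apply: proper_card.
have lts : (key s' < key s)%O by apply: et; case: se.
apply/properP; split; last by exists s'; rewrite !inE ?ltxx.
by apply/subsetP => t; rewrite !inE => /lt_trans; apply.
Qed.

(** If the chain never stabilizes, choose stages m_i and elements c_i that lie in
    L m_(i+1) but not in L m_i, with leading term as small as possible. For some
    i < j the leading term of c_j is the pullback of that of c_i. Subtracting a
    multiple of the pullback of c_i, which lies in L m_j, from c_j lowers the
    leading term; by minimality the difference lies in L m_j, so c_j does. *)
Theorem chain_condition : exists m, forall m' A (c : M A), (m <= m')%N -> L m' c -> L m c.
Proof.
apply: NNPP => nostab.
have step m : { x : nat * {A : Ob & (M A * S A)%type} |
   [/\ L x.1 (tagged x.2).1, ~ L m (tagged x.2).1, leading (tagged x.2).1 (tagged x.2).2,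
     (m <= x.1)%N &
    forall e : M (tag x.2), L x.1 e -> (forall t, e t != 0 -> (key t < key (tagged x.2).2)%O) -> L m e] }.
  apply: constructive_indefinite_description; apply: NNPP => no; apply: nostab.
  exists m => m' A c le_m Lc; apply: NNPP => nLc; apply: no.
  have [d [s [Ld nLd ds dmin]]] := leading_gap Lc nLc.
  by exists (m', Tagged (fun A => (M A * S A)%type) (d, s)).
pose mm := fix mm i := if i is i'.+1 then (sval (step (mm i'))).1 else 0%N.
have mmS i : (mm i <= mm i.+1)%N by case: (svalP (step (mm i))).
have mm_le i j : (i <= j)%N -> (mm i <= mm j)%N.
  move=> /subnK<-; elim: (j - i)%N => // n; rewrite addSn => IH.
  exact: leq_trans IH (mmS _).
pose x i := sval (step (mm i)).
have [i [j [lt_ij [u us um]]]] := good_pair (fun i => (tagged (x i).2).2).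
have [Li nLi si _ _] := svalP (step (mm i)).
have [Lj nLj sj _ jmin] := svalP (step (mm j)).
rewrite -/(x i) -/(x j) in Li nLi si Lj nLj sj jmin us um *.
set ci := (tagged (x i).2).1 in Li nLi si us.
set cj := (tagged (x j).2).1 in Lj nLj sj us.
set ti := (tagged (x i).2).2 in si us; set tj := (tagged (x j).2).2 in sj us jmin.
have Lu : L (mm j) (free_map (pb u) ci).
  by apply: Lpb; apply: Lmono_le Li; exact: (mm_le i.+1).
have := leading_map um si; rewrite us => -[uj umax].
pose a := cj tj / free_map (pb u) ci tj.
apply: nLj; rewrite -[cj](subrK (a *: free_map (pb u) ci)).
apply: Llin => //; apply: jmin => [|t].
  by rewrite -scaleNr; apply: Llin => //; apply: Lmono_le Lu; exact: mmS.
rewrite 3!ffunE => et; have tj_t : t != tj.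
  by apply: contraNneq et => ->; rewrite [_ *: _]divfK // subrr.
rewrite lt_neqAle (inj_eq (@key_inj _)) tj_t /=.
have [cjt|cjt] := eqVneq (cj t) 0; last by case: sj => _; apply.
apply: umax; apply: contraNneq et => ->.
by rewrite cjt scaler0 subrr.
Qed.

End Groebner.

(** * Homomorphisms between finite abelian groups *)

Section Representatives.
Local Open Scope group_scope.
Implicit Types A B C : finGroupType.

(** Morphisms are conjugacy classes, which are singletons when the target is
    abelian; [rep] recovers the underlying homomorphism. *)
Definition rep B A (u : hom B A) : {ffun B -> A} := xchoose (existsP (valP u)).

Lemma repP B A (u : hom B A) : surj_hom (rep u) /\ val u = conj_class (rep u).
Proof. by have /andP[uS /eqP uE] := xchooseP (existsP (valP u)). Qed.

Lemma rep_inj B A : injective (@rep B A).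
Proof. by move=> u v uv; apply: val_inj; rewrite (repP u).2 (repP v).2 uv. Qed.

Lemma repM B A (u : hom B A) : {morph rep u : x y / x * y}.
Proof. by case/surj_homP: (repP u).1. Qed.

Lemma rep1 B A (u : hom B A) : rep u 1 = 1.
Proof. by apply: (mulgI (rep u 1)); rewrite -repM !mulg1. Qed.

Lemma rep_onto B A (u : hom B A) a : exists b, rep u b = a.
Proof. by case/surj_homP: (repP u).1. Qed.

Lemma conj_class_abelian B A (f : {ffun B -> A}) :
  abelian [set: A] -> conj_class f = [set f].
Proof.
move=> /centsP cA; apply/setP => g; rewrite inE; apply/imsetP/eqP.
  case=> a _ ->; apply/ffunP => x; rewrite ffunE conjgE cA ?inE // mulgK.
  by [].
move=> ->; exists 1; rewrite ?inE //.
by apply/ffunP => x; rewrite ffunE conjg1.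
Qed.

Lemma rep_hom_of B A (f : {ffun B -> A}) (fS : surj_hom f) :
  abelian [set: A] -> rep (hom_of fS) = f.
Proof.
move=> cA; have := (repP (hom_of fS)).2; rewrite /= !conj_class_abelian //.
by move/set1_inj.
Qed.

Lemma rep_comp C B A (u : hom B A) (v : hom C B) x :
  abelian [set: A] -> rep (comp_hom u v) x = rep u (rep v x).
Proof.
move=> cA; have uE : u = hom_of (repP u).1 by apply: val_inj; exact: (repP u).2.
have vE : v = hom_of (repP v).1 by apply: val_inj; exact: (repP v).2.
by rewrite [in LHS]uE [in LHS]vE comp_hom_of rep_hom_of // ffunE.
Qed.

Lemma hom_eqP B A (u v : hom B A) : rep u =1 rep v -> u = v.
Proof. by move=> uv; apply: rep_inj; apply/ffunP. Qed.

Lemma hom_exists B A (f : B -> A) : abelian [set: A] ->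
    {morph f : x y / x * y} -> (forall a, exists b, f b = a) ->
  exists u : hom B A, rep u =1 f.
Proof.
move=> cA fM fS; have gS : surj_hom (finfun f).
  apply/surj_homP; split=> [x y|a]; first by rewrite !ffunE fM.
  by have [b <-] := fS a; exists b; rewrite ffunE.
by exists (hom_of gS) => x; rewrite rep_hom_of // ffunE.
Qed.

End Representatives.

Section Bases.
Local Open Scope group_scope.
Implicit Types G Q : finGroupType.

Definition basis G (b : seq G) (H : {group G}) := \big[dprod/1]_(x <- b) <[x]> = H.

Lemma basis_sub G (b : seq G) (H K : {group G}) :
  basis b H -> {subset b <= K} -> H \subset K.
Proof.
rewrite /basis; elim: b H => [|x b IH] H; first by rewrite big_nil => <-; rewrite sub1G.
rewrite big_cons; case/dprodP=> [[_ H' _ defH'] <- _ _] bK.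
rewrite mul_subG ?cycle_subG ?bK ?mem_head // defH'; apply: (IH _ defH') => y yb.
by rewrite bK // inE yb orbT.
Qed.

Lemma basis_mem G (b : seq G) (H : {group G}) : basis b H -> {subset b <= H}.
Proof.
rewrite /basis; elim: b H => // z b IHb H.
rewrite big_cons; case/dprodP=> [[_ K _ defK] <- _ _] y.
rewrite defK in_cons => /orP[/eqP->|/(IHb _ defK) yK].
  by rewrite -{1}[z]mulg1 mem_mulg ?cycle_id ?group1.
by rewrite -{1}[y]mul1g mem_mulg ?group1.
Qed.

(** The universal property of a direct product of cyclic groups. *)
Lemma basis_hom G Q (b : seq G) (q : seq Q) (H : {group G}) :
    basis b H -> abelian [set: Q] -> size q = size b ->
    (forall i, i < size b -> #[nth 1 q i] %| #[nth 1 b i]) ->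
  exists f : G -> Q, {in H &, {morph f : x y / x * y}} /\
    forall i, i < size b -> f (nth 1 b i) = nth 1 q i.
Proof.
rewrite /basis => + cQ; elim: b H q => [|x b IH] H [|y q] //=.
  by rewrite big_nil => <- _ _; exists (fun=> 1); split=> // ? ? _ _; rewrite mulg1.
rewrite big_cons => defH [sz] dvd; case/dprodP: (defH) => [[_ K _ defK] _ _ _].
have [f [fM fb]] := IH _ q defK sz (fun i => dvd i.+1).
have /= dvd_y := dvd 0 isT.
pose fK := Morphism fM.
rewrite defK in defH.
have cfHK : fK @* K \subset 'C(eltm_morphism dvd_y @* <[x]>).
  by apply: (sub_abelian_cent2 cQ); apply: subsetT.
exists (dprodm defH cfHK); split=> [u v uH vH|[_|i lt_i]].
- exact: (morphM (dprodm_morphism defH cfHK)).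
- rewrite /= dprodmEl ?cycle_id //=; exact: eltm_id.
- rewrite /= dprodmEr /= ?fb //; apply: (basis_mem defK); exact: mem_nth.
Qed.

End Bases.

Section Generating.
Local Open Scope group_scope.
Implicit Types A B C : finGroupType.

(** Stated with subgroups rather than with the generated subgroup, so that it is
    directly an induction principle. *)
Definition generates A (q : seq A) :=
  forall K : {group A}, {subset q <= K} -> forall x, x \in K.

Lemma basis_generates A (b : seq A) : basis b [set: A]%G -> generates b.
Proof.
by move=> bA K /(basis_sub bA)/subsetP sK x; apply: sK; rewrite inE.
Qed.

Definition rep_morphism B A (u : hom B A) := @Morphism _ _ [set: B] (rep u) (in2W (repM u)).

Lemma generates_map B A (u : hom B A) (b : seq B) :
  generates b -> generates (map (rep u) b).
Proof.
move=> gb K bK y; have [x <-] := rep_onto u y.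
suff: x \in (rep_morphism u @*^-1 K)%G by rewrite !inE.
by apply: gb => {}x xb; rewrite !inE; apply/bK/map_f.
Qed.

Lemma hom_ext B A (u v : hom B A) (b : seq B) :
  generates b -> {in b, rep u =1 rep v} -> u = v.
Proof.
move=> gb uv; pose E := [set x | rep u x == rep v x].
have gE : group_set E.
  apply/group_setP; split=> [|x y]; rewrite !inE ?rep1 // => /eqP fx /eqP fy.
  by rewrite !repM fx fy.
apply: hom_eqP => x; have := gb (Group gE) _ x.
rewrite inE => uvx; apply/eqP/uvx => y /uv; by rewrite inE => ->.
Qed.

Lemma hom_of_basis B A (b : seq B) (q : seq A) :
    abelian [set: A] -> basis b [set: B]%G -> generates q -> size q = size b ->
    (forall i, i < size b -> #[nth 1 q i] %| #[nth 1 b i]) ->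
  exists u : hom B A, map (rep u) b = q.
Proof.
move=> cA bB gq sz dvd; have [f [fM fb]] := basis_hom bB cA sz dvd.
have {}fM : {morph f : x y / x * y} by move=> x y; apply: fM; rewrite inE.
have f_onto a : exists b, f b = a.
  pose fm := @Morphism _ _ [set: B] f (in2W fM).
  have /morphimP[x _ _ ->] : a \in (fm @* [set: B])%G.
    apply: gq => y /(nthP 1)[i lt_i <-]; rewrite -fb -?sz //.
    by rewrite (mem_morphim fm) ?inE.
  by exists x.
have [u uE] := hom_exists cA fM f_onto; exists u.
apply: (@eq_from_nth _ 1); rewrite size_map ?sz // => i lt_i.
by rewrite (nth_map 1) // uE fb.
Qed.

(** A subgroup of B is everything as soon as it contains the kernel of v and maps
    onto the target. *)
Lemma generates_lift B A (v : hom B A) (K : {group B}) (q : seq A) :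
    generates q -> (forall x, rep v x = 1 -> x \in K) ->
    (forall y, y \in q -> exists2 x, x \in K & rep v x = y) ->
  forall x, x \in K.
Proof.
move=> gq kK lift x.
have /morphimP[y _ yK xy] : rep v x \in (rep_morphism v @* K)%G.
  apply: gq => y /lift[z zK <-]; by rewrite (mem_morphim (rep_morphism v)) ?inE.
rewrite -[x](mulgKV y) groupM //; apply: kK; rewrite repM xy.
by rewrite -repM mulgV rep1.
Qed.

End Generating.

Section PGroups.
Local Open Scope group_scope.
Variable p : nat.
Hypothesis p_pr : prime p.
Implicit Types G Q : finGroupType.

Lemma pnat_dvdn a b : p.-nat a -> p.-nat b -> a <= b -> a %| b.
Proof.
move=> /p_natP[m ->] /p_natP[n ->]; rewrite leq_exp2l ?prime_gt1 //.
exact: dvdn_exp2l.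
Qed.

Lemma sorted_basis G : p.-group [set: G] && abelian [set: G] ->
  {b : seq G | basis b [set: G]%G /\ sorted leq (map order b)}.
Proof.
case/andP=> _ cG; apply: constructive_indefinite_description.
have [b defG ordb] := abelian_structure cG.
exists (rev b); split; last first.
  by rewrite map_rev rev_sorted ordb abelian_type_sorted.
rewrite /basis (perm_big b) //=; by rewrite perm_rev.
Qed.

Lemma order_dvd G Q (x : G) (y : Q) :
  p.-group [set: G] -> p.-group [set: Q] -> #[x] <= #[y] -> #[x] %| #[y].
Proof. by move=> pG pQ; apply: pnat_dvdn; exact: mem_p_elt (in_setT _). Qed.

End PGroups.

(** * Noetherianity of the sets of surjections onto fixed groups *)

Section SurjectionWords.
Variables (p : nat) (p_pr : prime p) (U : family) (UZ : forall G, U G -> Zfam p G).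
Variables (I : finType) (G_ : I -> obj (Zfam p)).
Implicit Types A B : obj U.

Definition surjs A : finType := {i : I & hom A (G_ i)}.

Definition surjs_pb A B (u : hom B A) (s : surjs A) : surjs B :=
  Tagged (fun i => hom B (G_ i)) (comp_hom (tagged s) u).

Definition letter : finType := {i : I & G_ i}.

(** The unit in front of the basis makes the first letter of every word the unit
    of G_i, so that words of surjections onto different G_i differ even when the
    group A is trivial. *)
Definition frame A : seq A := 1%g :: sval (sorted_basis (UZ (obj_in A))).

Definition word A (s : surjs A) : seq letter :=
  [seq Tagged G_ (rep (tagged s) x) | x <- frame A].

Definition key A (s : surjs A) : seqlexi nat :=
  [seq enum_rank t : nat | t <- word s].

Lemma abelianZ (G : obj (Zfam p)) : abelian [set: G].
Proof. by case/andP: (obj_in G). Qed.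

Lemma abelianU A : abelian [set: A].
Proof. by case/andP: (UZ (obj_in A)). Qed.

Lemma pgroupU A : (p.-group [set: A])%g.
Proof. by case/andP: (UZ (obj_in A)). Qed.

Lemma frame_basis A : basis (behead (frame A)) [set: A]%G.
Proof. by case: (svalP (sorted_basis (UZ (obj_in A)))). Qed.

Lemma frame_sorted A : sorted leq (map order (frame A)).
Proof.
have [_] := svalP (sorted_basis (UZ (obj_in A))); rewrite /frame /= order1.
by case: (sval _) => //= x b ->; rewrite order_gt0.
Qed.

Lemma word_inj A : injective (@word A).
Proof.
move=> [i f] [j g] []; rewrite /= !rep1 => ij _; subst j.
move/eq_in_map=> fg; congr existT.
apply: (hom_ext (basis_generates (frame_basis A))) => x /fg/eqP.
by rewrite -tag_eqE /tag_eq eqxx /= tagged_asE => /eqP.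
Qed.

Lemma key_inj A : injective (@key A).
Proof.
by move=> s t /inj_map/word_inj; apply => x y /ord_inj/enum_rank_inj.
Qed.

Lemma size_word A (s : surjs A) : size (word s) = size (frame A).
Proof. exact: size_map. Qed.

(** Higman's lemma provides i < j and a substitution ph between the decorated
    words. Mapping the l-th frame element of A_j to the ph(l)-th one of A_i
    respects orders, since these are powers of p that increase, and is onto
    because ph is. *)
Theorem surjs_good_pair (A : nat -> obj U) (s : forall m, surjs (A m)) :
  exists i j, i < j /\
    exists2 u : hom (A j) (A i), surjs_pb u (s i) = s j & monotone surjs_pb key u.
Proof.
pose lw m := [seq (Tagged G_ (rep (tagged (s m)) x), #[x]%g) | x <- frame (A m)].
have lw1 m : map fst (lw m) = word (s m) by rewrite -map_comp.
have lw2 m : map snd (lw m) = map order (frame (A m)) by rewrite -map_comp.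
have [i [j [lt_ij eij]]] := higman (fun m => annot set0 (lw m)).
exists i, j; split=> //.
pose t0 : letter := Tagged G_ (1%g : G_ (tag (s i))).
have [|||ph [rg sz phP]] := emb_annot t0 (u := [::]) _ _ _ eij.
- by move=> x; rewrite inE.
- by rewrite lw2 frame_sorted.
- by [].
rewrite add0n !size_map in rg sz phP.
have {phP}phP l : l < size ph ->
    nth t0 (word (s i)) (nth 0 ph l) = nth t0 (word (s j)) l
    /\ #[nth 1 (frame (A i)) (nth 0 ph l)]%g <= #[nth 1 (frame (A j)) l]%g.
  move=> lt_l; have [] := phP l lt_l; rewrite cat0s !lw1 !lw2 => ->.
  have [_ /allP ph_lt] := andP (rgf_lt rg).
  rewrite (nth_map 1%g) ?(nth_map 1%g) // -?sz //; apply: ph_lt; exact: mem_nth.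
case: ph => // j0 ph in rg sz phP; have sz_fr := sz; case: sz => sz.
(* The first value of ph is 0, so the unit goes to the unit, and the words s i
   and s j start with the same letter, that is, have the same index in I. *)
have rg_j0 : j0 = 0 by move: rg => /= /andP[/eqP].
subst j0; set b := behead (frame (A j)).
have sz_b : size ph = size b by rewrite sz /b /frame.
have [|||u ub] := hom_of_basis (q := [seq nth 1%g (frame (A i)) l | l <- ph])
    (abelianU (A i)) (frame_basis (A j)).
- move=> K qK; apply: (basis_generates (frame_basis (A i))) => x xb.
  have xfr : x \in frame (A i) by rewrite in_cons xb orbT.
  have : index x (frame (A i)) \in 0 :: ph by apply: (rgf_mem rg); rewrite index_mem.
  rewrite in_cons => /predU1P[x0|x_ph]; last first.
    by apply: qK; apply/mapP; exists (index x (frame (A i))); rewrite ?nth_index.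
  by rewrite -(nth_index 1%g xfr) x0 group1.
- by rewrite size_map.
- move=> l lt_l; rewrite (nth_map 0) ?sz_b //.
  apply: (order_dvd p_pr (pgroupU _) (pgroupU _)).
  by have [|_] := phP l.+1; rewrite /= ?ltnS ?sz_b.
have uE l : l < (size ph).+1 ->
    rep u (nth 1%g (frame (A j)) l) = nth 1%g (frame (A i)) (nth 0 (0 :: ph) l).
  case: l => [|l] /=; rewrite ?rep1 // ltnS => lt_l.
  by rewrite -(nth_map 1%g 1%g) -?sz_b // ub (nth_map 0).
have pbE (t : surjs (A i)) l : l < (size ph).+1 ->
    nth t0 (word (surjs_pb u t)) l = nth t0 (word t) (nth 0 (0 :: ph) l).
  move=> lt_l; have [_ /allP ph_lt] := andP (rgf_lt rg).
  rewrite (nth_map 1%g); last by rewrite -sz_fr.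
  rewrite (nth_map 1%g); last by apply: ph_lt; apply: mem_nth.
  by rewrite /= rep_comp ?uE //; exact: abelianZ.
exists u.
  apply: word_inj; apply: (@eq_from_nth _ t0); first by rewrite !size_word.
  move=> l; rewrite size_word -sz_fr => lt_l.
  by rewrite pbE //; have [] := phP l lt_l.
move=> t t' lt_tt'.
apply: (lexi_rgf (s := key t) (t := key t') rg);
  rewrite ?size_map ?size_word // => l lt_l.
all: have [_ /allP ph_lt] := andP (rgf_lt rg).
all: have lt_ph : nth 0 (0 :: ph) l < size (frame (A i));
  first by apply: ph_lt; apply: mem_nth.
all: by rewrite !(nth_map t0) ?size_word // ?pbE // -?sz_fr.
Qed.

End SurjectionWords.

(** * Epimorphisms of presheaves are pointwise surjective *)

(** Epimorphisms are defined by cancellation, so surjectivity is tested against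
    the pointwise cokernel. *)
Section Cokernel.
Local Open Scope ring_scope.
Local Open Scope quotient_scope.
Variables (k : fieldType) (U : family) (X Y : presheaf k U) (phi : nat_trans X Y).

Definition image_pred (T : obj U) : {pred Y T} :=
  fun y => asbool (exists x, phi T x = y).
Local Notation repr := generic_quotient.repr.
Arguments image_pred : clear implicits.

Lemma image_predP T y : reflect (exists x, phi T x = y) (y \in image_pred T).
Proof. exact: asboolP. Qed.

Lemma image_zmod T : zmod_closed (image_pred T).
Proof.
split=> [|y z]; first by apply/image_predP; exists 0; rewrite linear0.
move=> /image_predP[x <-] /image_predP[x' <-]; apply/image_predP.
by exists (x - x'); rewrite linearB.
Qed.
HB.instance Definition _ T :=
  GRing.isZmodClosed.Build (Y T) (image_pred T) (image_zmod T).

Definition cokernel T := @Quotient.quot (Y T) (image_pred T).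
HB.instance Definition _ T := GRing.Zmodule.on (cokernel T).
Local Notation Q := cokernel.

Definition pi T (y : Y T) : Q T := \pi_(Q T) y.

Lemma pi_repr T (x : Q T) : pi (repr x) = x.
Proof. exact: reprK. Qed.

Lemma piD T (x y : Y T) : pi (x + y) = pi x + pi y.
Proof. exact: (raddfD (\pi_(@Quotient.quot (Y T) (image_pred T)))). Qed.

Lemma pi_eqP T (x y : Y T) : pi x = pi y <-> exists z, phi T z = x - y.
Proof.
rewrite (rwP (image_predP _)) Quotient.idealrBE.
by split=> [/eqP|/eqP].
Qed.

Definition scaleq T (a : k) (x : Q T) : Q T := pi (a *: repr x).

Lemma pi_scaleq T a (x : Y T) : pi (a *: x) = scaleq a (pi x).
Proof.
apply/pi_eqP; have /pi_eqP[z zE] := esym (pi_repr (pi x)).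
by exists (a *: z); rewrite linearZ /= zE scalerBr.
Qed.

Lemma scaleqA T a b (x : Q T) : scaleq a (scaleq b x) = scaleq (a * b) x.
Proof. by rewrite -[x]pi_repr -!pi_scaleq scalerA. Qed.

Lemma scale1q T : left_id 1 (@scaleq T).
Proof. by move=> x; rewrite -[x]pi_repr -pi_scaleq scale1r. Qed.

Lemma scaleqDr T : right_distributive (@scaleq T) +%R.
Proof.
by move=> a x y; rewrite -[x]pi_repr -[y]pi_repr -piD -!pi_scaleq scalerDr piD.
Qed.

Lemma scaleqDl T (v : Q T) : {morph (@scaleq T)^~ v : a b / a + b}.
Proof. by move=> a b; rewrite -[v]pi_repr -!pi_scaleq scalerDl piD. Qed.

HB.instance Definition _ T := GRing.Zmodule_isLmodule.Build k (Q T)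
  (@scaleqA T) (@scale1q T) (@scaleqDr T) (@scaleqDl T).

Lemma pi_linear T : linear (@pi T).
Proof. by move=> a x y; rewrite piD pi_scaleq. Qed.
HB.instance Definition _ T :=
  GRing.isLinear.Build k (Y T) (Q T) _ (@pi T) (@pi_linear T).

Definition coker_map (B A : obj U) (u : hom B A) (x : Q A) : Q B :=
  pi (psh_map Y u (repr x)).

Lemma coker_map_pi (B A : obj U) (u : hom B A) (y : Y A) :
  coker_map u (pi y) = pi (psh_map Y u y).
Proof.
apply/pi_eqP; have /pi_eqP[z zE] := pi_repr (pi y).
by exists (psh_map X u z); rewrite nat_appP zE linearB.
Qed.

Lemma coker_map_linear (B A : obj U) (u : hom B A) : linear (coker_map u).
Proof.
by move=> a x y; rewrite -[x]pi_repr -[y]pi_repr -linearP !coker_map_pi !linearP.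
Qed.
HB.instance Definition _ (B A : obj U) (u : hom B A) :=
  GRing.isLinear.Build k (Q A) (Q B) _ (coker_map u) (coker_map_linear u).

Definition coker : presheaf k U.
Proof.
exists (fun T => Q T : lmodType k) (fun B A u => coker_map u).
- by move=> A x; rewrite -[x]pi_repr /= coker_map_pi psh_map_id.
- by move=> C B A u v x; rewrite -[x]pi_repr /= !coker_map_pi psh_map_comp.
Defined.

Definition coker_pi : nat_trans Y coker.
Proof.
by exists (fun T => @pi T : {linear Y T -> Q T}) => B A u x; rewrite /= coker_map_pi.
Defined.

Definition coker_zero : nat_trans Y coker.
Proof.
by exists (fun T => \0 : {linear Y T -> Q T}) => B A u x; rewrite linear0.
Defined.

Lemma epi_surjective : epimorphism phi -> forall T y, exists x, phi T x = y.
Proof.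
move=> epi T y; have {}epi := epi coker coker_pi coker_zero.
have /epi/(_ T y) : forall S x, coker_pi S (phi S x) = coker_zero S (phi S x).
  move=> S x.
  rewrite /= -(linear0 (@pi S)); apply/pi_eqP; exists x; by rewrite subr0.
rewrite /= -(linear0 (@pi T)) => /pi_eqP[z]; rewrite subr0; by exists z.
Qed.

End Cokernel.

Section Generators.
Local Open Scope ring_scope.
Variables (k : fieldType) (U : family).

Definition ev (X : presheaf k U) (I : finType) (G_ : I -> obj U)
    (x_ : forall i, X (G_ i)) (T : obj U) (c : free_mod k {i : I & hom T (G_ i)}) : X T :=
  \sum_s (c s : k) *: psh_map X (tagged s) (x_ (tag s)).

Definition spanned (X : presheaf k U) (I : finType) (G_ : I -> obj U) (x_ : forall i, X (G_ i)) :=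
  forall T (y : X T), exists c, ev x_ c = y.

Lemma ev_linear (X : presheaf k U) (I : finType) (G_ : I -> obj U) (x_ : forall i, X (G_ i)) T :
  linear (@ev X I G_ x_ T).
Proof.
move=> a c d; rewrite /ev scaler_sumr -big_split; apply: eq_bigr => s _ /=.
by rewrite !ffunE scalerDl scalerA.
Qed.

Section Span.
Variables (X : presheaf k U) (I : finType) (G_ : I -> obj U) (x_ : forall i, X (G_ i)).

Lemma ev_basis (T : obj U) i (f : hom T (G_ i)) :
  ev x_ (basis_elt k (Tagged (fun i => hom T (G_ i)) f)) = psh_map X f (x_ i).
Proof.
rewrite /ev (bigD1 (Tagged (fun i => hom T (G_ i)) f)) //= big1 => [|s sf].
  by rewrite ffunE eqxx scale1r addr0.
by rewrite ffunE (negPf sf) scale0r.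
Qed.

Lemma span_sum (T : obj U) (J : finType) (a : J -> k) (i : J -> I) (f : forall j, hom T (G_ (i j))) :
  exists c, ev x_ c = \sum_j a j *: psh_map X (f j) (x_ (i j)).
Proof.
exists (\sum_j a j *: basis_elt k (Tagged (fun i => hom T (G_ i)) (f j))).
pose F := GRing.isLinear.Build k _ _ _ _ (@ev_linear X I G_ x_ T).
pose FL : {linear free_mod k {i : I & hom T (G_ i)} -> X T} := HB.pack (@ev X I G_ x_ T) F.
rewrite -[LHS]/(FL _) linear_sum; apply: eq_bigr => j _.
by rewrite linearZ /= ev_basis.
Qed.

End Span.

(** By induction on the list of groups, splitting off the image of the unit of the
    first summand. *)
Lemma fg_spanned (X : presheaf k U) : finitely_generated X ->
  exists (I : finType) (G_ : I -> obj U) (x_ : forall i, X (G_ i)), spanned x_.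
Proof.
case=> Gs [phi /epi_surjective phi_onto].
suff [I [G_ [x_ xP]]] : exists (I : finType) (G_ : I -> obj U) (x_ : forall i, X (G_ i)),
   forall T z, exists c, ev x_ c = phi T z.
  exists I, G_, x_ => T y; have [z <-] := phi_onto T y; exact: xP.
elim: Gs phi {phi_onto} => [|G Gs IH] phi.
  pose G_ (i : void) : obj U := match i with end.
  pose x_ (i : void) : X (G_ i) := match i with end.
  exists void, G_, x_ => T z; exists 0.
  rewrite (_ : z = 0) ?linear0; last by apply/rowP; case.
  by rewrite /ev big1 // => -[[]].
pose phi2T T (z : foldr (fun G => dsum (e_psh k G)) (zero_psh k U) Gs T) : X T := phi T (0, z).
have phi2L T : linear (phi2T T).
  by move=> a y z; rewrite /phi2T -linearP; congr (phi T _); congr pair; rewrite /= scaler0 addr0.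
pose F T : {linear _ -> _} := HB.pack (phi2T T) (GRing.isLinear.Build k _ _ _ (phi2T T) (phi2L T)).
have FP (B A : obj U) (u : hom B A) z : F B (psh_map _ u z) = psh_map X u (F A z).
  rewrite /= /phi2T -nat_appP /= /dsum_map /=; congr (phi B (_, _)).
  by rewrite linear0.
have [I [G_ [x_ xP]]] := IH (NatTrans FP).
pose x0 : X G := phi G (basis_elt k (id_hom G), 0).
pose G_' i := if i is Some j then G_ j else G.
pose x_' i : X (G_' i) := match i with Some j => x_ j | None => x0 end.
exists (option I), G_', x_' => T [a z].
have -> : phi T (a, z) = phi T (a, 0) + F T z.
  by rewrite /= /phi2T -linearD; congr (phi T _); congr pair; rewrite /= ?addr0 ?add0r.
have [c <-] := xP T z.
have -> : phi T (a, 0) = \sum_f a f *: psh_map X f x0.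
  have phi1L : linear (fun a => phi T (a, 0) : X T).
    move=> b y y'; rewrite -linearP; congr (phi T _); congr pair.
    by rewrite /= scaler0 addr0.
  pose F1 : {linear free_mod k (hom T G) -> X T} :=
    HB.pack (fun a => phi T (a, 0) : X T) (GRing.isLinear.Build k _ _ _ _ phi1L).
  rewrite -[LHS]/(F1 a) [a in LHS]free_mod_sum linear_sum.
  apply: eq_bigr => f _; rewrite linearZ /= /x0 -nat_appP /=; congr (_ *: phi T _).
  by rewrite /dsum_map /= linear0 free_map_basis comp_idhom.
pose J := (hom T G + {i : I & hom T (G_ i)})%type.
have [c' c'E] := span_sum x_' (J := J) (T := T)
   (fun j => match j with inl f => a f | inr s => c s end)
   (fun j => match j return hom T (G_' (match j with inl f => None | inr s => Some (tag s) end)) with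
      inl f => f | inr s => tagged s end).
by exists c'; rewrite c'E big_sumType.
Qed.

End Generators.

(** * Torsion, generation and central stability *)

Lemma free_mod_ext (k : fieldType) (S : finType) (V : lmodType k)
    (f g : {linear free_mod k S -> V}%R) :
  (forall s, f (basis_elt k s) = g (basis_elt k s)) -> f =1 g.
Proof.
move=> fg c; rewrite (free_mod_sum c) !linear_sum; apply: eq_bigr => s _.
by rewrite !linearZ fg.
Qed.

Section Applications.
Local Open Scope ring_scope.
Variables (k : fieldType) (p : nat) (p_pr : prime p) (X : presheaf k (Zfam p)).
Variables (I : finType) (G_ : I -> obj (Zfam p)) (x_ : forall i, X (G_ i)).
Hypothesis x_span : spanned x_.

Lemma ev_map (B A : obj (Zfam p)) (u : hom B A) (c : free_mod k {i : I & hom A (G_ i)}) :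
  ev x_ (free_map (fun s : {i : I & hom A (G_ i)} =>
     Tagged (fun i => hom B (G_ i)) (comp_hom (tagged s) u)) c) = psh_map X u (ev x_ c).
Proof.
pose F (T : obj (Zfam p)) : {linear free_mod k {i : I & hom T (G_ i)} -> X T} :=
  HB.pack (@ev _ _ X I G_ x_ T) (GRing.isLinear.Build k _ _ _ _ (@ev_linear _ _ X I G_ x_ T)).
apply: (free_mod_ext (f := F B \o free_map _) (g := psh_map X u \o F A)) => -[i f].
by rewrite /= free_map_basis !ev_basis psh_map_comp.
Qed.

Section Restricted.
Variables (U : family) (UZ : forall G, U G -> Zfam p G).
Local Notation in_Z := (@incl U (Zfam p) UZ).

(** Full subcategories inherit the chain condition: only the test groups A are
    restricted, while the G_ i need not belong to U. *)
Lemma chain_stable (L : nat -> forall A : obj U, free_mod k (surjs G_ A) -> Prop) :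
    (forall m A, L m A 0) ->
    (forall m A a (c d : free_mod k (surjs G_ A)), L m A c -> L m A d -> L m A (c + a *: d)) ->
    (forall m (A B : obj U) (u : hom B A) (c : free_mod k (surjs G_ A)),
       L m A c -> L m B (free_map (surjs_pb u) c)) ->
    (forall m A (c : free_mod k (surjs G_ A)), L m A c -> L m.+1 A c) ->
  exists m, forall m' A (c : free_mod k (surjs G_ A)), (m <= m')%N -> L m' A c -> L m A c.
Proof. exact: chain_condition (@key_inj p U UZ I G_) (@surjs_good_pair p p_pr U UZ I G_) L. Qed.

(** A torsion element is killed by all maps with a large source, since these factor
    through any given v. So the elements killed by all maps with source of order
    at least m exhaust the torsion as m grows, and they form a stationary chain. *)
Lemma eventually_torsion_freeP (r : nat) :
    (forall (A B : obj U) (v : hom B A), (r <= #|A|)%N ->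
       exists m, forall (C : obj U) (f : hom C A), (m <= #|C|)%N ->
         exists g : hom C B, f = comp_hom v g) ->
  eventually_torsion_free (restrict UZ X).
Proof.
move=> fact; set Y := restrict UZ X.
pose F (A : obj U) : {linear free_mod k (surjs G_ A) -> Y A} :=
  HB.pack (@ev _ _ X I G_ x_ (in_Z A))
    (GRing.isLinear.Build k _ _ _ _ (@ev_linear _ _ X I G_ x_ (in_Z A))).
pose L m (A : obj U) (c : free_mod k (surjs G_ A)) :=
  forall (C : obj U) (f : hom C A), (m <= #|C|)%N -> psh_map Y f (F A c) = 0.
have [||||m mP] := @chain_stable L.
- by move=> m A C f _; rewrite !linear0.
- by move=> m A a c d Lc Ld C f leC; rewrite linearD linearZ linearD linearZ /= Lc ?Ld // scaler0 addr0.
- move=> m A B u c Lc C f leC; rewrite /= (@ev_map (in_Z B) (in_Z A)).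
  by have := Lc C (comp_hom u f) leC; rewrite psh_map_comp.
- by move=> m A c Lc C f leC; apply: Lc; exact: leq_trans leC.
exists (maxn r m) => B A v; rewrite geq_max => /andP[le_r le_m] y y' yy'.
have [m' m'P] := fact A B v le_r.
have [c cE] := x_span (y - y' : X (in_Z A)).
have {}cE : F A c = y - y' := cE.
apply/eqP; rewrite -subr_eq0 -cE; apply/eqP.
have := mP (maxn m m') A c (leq_maxl _ _) _ A (id_hom A) le_m.
rewrite psh_map_id; apply=> C f; rewrite geq_max => /andP[_ /(m'P C f)[g ->]].
have -> : psh_map Y (comp_hom v g) (F A c) = psh_map Y g (psh_map Y v (F A c)).
  by rewrite psh_map_comp.
by rewrite cE linearB /= yy' subrr linear0.
Qed.

Lemma generated_in_finite_degreeP (r : nat) :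
    (forall i (A B : obj U) (f : hom B (G_ i)), (r <= #|A| <= #|B|)%N ->
       exists (g : hom A (G_ i)) (u : hom B A), f = comp_hom g u) ->
  generated_in_finite_degree (restrict UZ X).
Proof.
move=> fact; exists r => A B leAB y.
have [c <-] := x_span (y : X (in_Z B)).
pose gu (s : surjs G_ B) := constructive_indefinite_description _ (fact _ A B (tagged s) leAB).
have guP s : exists u, tagged s = comp_hom (sval (gu s)) u := svalP (gu s).
pose u s := sval (constructive_indefinite_description _ (guP s)).
have uP s : tagged s = comp_hom (sval (gu s)) (u s).
  exact: (svalP (constructive_indefinite_description _ (guP s))).
pose z s : restrict UZ X A :=
  @psh_map k _ X (in_Z A) (G_ (tag s)) (sval (gu s)) (x_ (tag s)).
pose F : {linear tensor (restrict UZ X A) (hom B A) -> restrict UZ X B} :=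
  HB.pack (@act k U (restrict UZ X) A B)
    (GRing.isLinear.Build k _ _ _ _ (@act_linear k U (restrict UZ X) A B)).
exists (\sum_s pure (c s *: z s) (basis_elt k (u s))).
rewrite -[LHS]/(F _) linear_sum; apply: eq_bigr => s _.
rewrite /= act_pure linearZ /=; congr (_ *: _).
rewrite [in RHS]uP.
by rewrite (@psh_map_comp k _ X (in_Z B) (in_Z A) (G_ (tag s)) (sval (gu s)) (u s)).
Qed.

End Restricted.

Lemma rep_repr_coset (G Q : obj (Zfam p)) (u : hom G Q) (H : {group G}) x :
    (H <| [set: G])%g -> (forall h, h \in H -> rep u h = 1%g) ->
  rep u (repr (coset H x)) = rep u x.
Proof.
move=> /andP[_ /subsetP nH] uH; rewrite val_coset ?nH ?inE //.
by case: repr_rcosetP => h Hh; rewrite repM uH ?mul1g.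
Qed.

Lemma rep_proj (G : obj (Zfam p)) n (H : Nsub G n) x : rep (proj H) x = coset (val H) x.
Proof. by rewrite rep_hom_of ?ffunE //; exact: (abelianZ (quot H)). Qed.

Lemma proj_rep1 (G : obj (Zfam p)) n (H : Nsub G n) x : x \in val H -> rep (proj H) x = 1%g.
Proof. by rewrite rep_proj; exact: coset_id. Qed.

Lemma comp_proj2 (G : obj (Zfam p)) n (H H' : Nsub G n) (sHH' : val H \subset val H') :
  comp_hom (proj2 sHH') (proj H) = proj H'.
Proof.
apply: hom_eqP => x; have cH' := abelianZ (quot H').
rewrite rep_comp // rep_hom_of // ffunE rep_proj -rep_proj.
rewrite rep_repr_coset ?rep_proj //; first exact: Nsub_normal.
by move=> h /(subsetP sHH'); exact: proj_rep1.
Qed.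

Lemma comp_hom_cancel (C B A : obj (Zfam p)) (v : hom C B) (u w : hom B A) :
  comp_hom u v = comp_hom w v -> u = w.
Proof.
move=> uvw; apply: hom_eqP => b; have [c <-] := rep_onto v b.
by rewrite -!rep_comp ?uvw //; exact: abelianZ.
Qed.

(** The quotient by the kernel of u, which is the largest subgroup through whose
    quotient u factors. *)
Lemma kernel_factor n (G Q : obj (Zfam p)) (u : hom G Q) : (#|Q| <= n)%N ->
  exists (H : Nsub G n) (v : hom (quot H) Q),
    comp_hom v (proj H) = u /\ forall x, rep u x = 1%g -> x \in val H.
Proof.
move=> leQ.
pose f := @Morphism _ _ [set: G] (rep u) (in2W (repM u)).
have nK : (('ker f)%G <| [set: G])%g by exact: ker_normal.
have leK : (#|[set: G] / 'ker f|%g <= n)%N.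
  rewrite (card_isog (first_isog f)); apply: leq_trans leQ.
  by rewrite -cardsT; apply/subset_leq_card/subsetT.
have HP : ('ker f <| [set: G])%g && (#|[set: G] / 'ker f|%g <= n)%N by rewrite nK leK.
pose H : Nsub G n := exist _ ('ker f)%G HP.
have kerE x : (x \in 'ker f)%g = (rep u x == 1%g) by rewrite !inE.
have uH x : rep u (repr (coset ('ker f)%G x)) = rep u x.
  by apply: rep_repr_coset => // h; rewrite kerE => /eqP.
have [||v vE] := hom_exists (abelianZ Q) (f := fun a : quot H => rep u (repr a)).
- move=> a b; case: (cosetP a) => x Nx ->; case: (cosetP b) => y Ny ->.
  by rewrite -morphM // !uH repM.
- move=> a; have [x <-] := rep_onto u a; exists (coset ('ker f)%G x); exact: uH.
exists H, v; split=> [|x ux]; last by rewrite kerE ux.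
apply: hom_eqP => x; rewrite rep_comp; last exact: abelianZ.
by rewrite vE rep_proj uH.
Qed.

(** The value of a cocone on an element pulled back along G -> Q can be computed at
    any quotient through which G -> Q factors: all of them map to the quotient by
    the kernel, which is G/H' here. *)
Lemma cocone_indep n (G Q : obj (Zfam p)) (W : lmodType k) (d : cocone X G n W)
    (H H' : Nsub G n) (v : hom (quot H') Q) (w : hom (quot H) Q) x :
    comp_hom w (proj H) = comp_hom v (proj H') ->
    (forall z, rep (comp_hom v (proj H')) z = 1%g -> z \in val H') ->
  d H (psh_map X w x) = d H' (psh_map X v x).
Proof.
move=> wv kv; have sHH' : val H \subset val H'.
  apply/subsetP => z zH; apply: kv; rewrite -wv rep_comp; last exact: abelianZ.
  by rewrite proj_rep1 // rep1.
have -> : w = comp_hom v (proj2 sHH').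
  by apply: (@comp_hom_cancel G (quot H) Q (proj H)); rewrite -comp_homA comp_proj2.
by rewrite (@psh_map_comp k _ X (quot H) (quot H') Q) /= legP.
Qed.

(** The relations that follow from those on groups of order at most m form an
    increasing chain, whose union consists of all relations. Being a consequence
    is expressed by membership in every subspace P that contains the given
    relations. *)
Lemma relations_bounded : exists m, forall (G : obj (Zfam p)) (c : free_mod k (surjs G_ G)),
    ev x_ c = 0 -> forall P : free_mod k (surjs G_ G) -> Prop,
    P 0 -> (forall a c d, P c -> P d -> P (c + a *: d)) ->
    (forall (Q : obj (Zfam p)) (u : hom G Q) (e : free_mod k (surjs G_ Q)), (#|Q| <= m)%N ->
       ev x_ e = 0 -> P (free_map (surjs_pb u) e)) ->
  P c.
Proof.
pose L m (G : obj (Zfam p)) c := forall P : free_mod k (surjs G_ G) -> Prop,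
    P 0 -> (forall a c d, P c -> P d -> P (c + a *: d)) ->
    (forall (Q : obj (Zfam p)) (u : hom G Q) (e : free_mod k (surjs G_ Q)), (#|Q| <= m)%N ->
       ev x_ e = 0 -> P (free_map (surjs_pb u) e)) ->
  P c.
have [||||m mP] := @chain_stable (Zfam p) (fun _ => id) L.
- by move=> m A P.
- move=> m A a c d Lc Ld P P0 PD Pg.
  exact: PD (Lc P P0 PD Pg) (Ld P P0 PD Pg).
- move=> m A B u c Lc P P0 PD Pg.
  apply: (Lc (fun c => P (free_map (surjs_pb u) c))) => [|a c1 c2 Pc1 Pc2|Q v e leQ e0].
  + by rewrite linear0.
  + by rewrite linearD linearZ; apply: PD.
  + rewrite (_ : free_map _ _ = free_map (surjs_pb (comp_hom v u)) e); first exact: Pg.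
    symmetry; apply: free_map_comp => -[i f]; by rewrite /surjs_pb /= comp_homA.
- move=> m A c Lc P P0 PD Pg; apply: Lc => // Q u e leQ.
  by apply: Pg; exact: leq_trans leQ _.
exists m => G c c0; apply: (mP (maxn m #|G|)); first exact: leq_maxl.
move=> P P0 PD Pg; have <- : free_map (surjs_pb (id_hom G)) c = c.
  by apply: free_map_id => -[i f]; rewrite /surjs_pb /= comp_homid.
by apply: Pg; rewrite ?leq_maxr.
Qed.

(** It is shown that X(G) itself, with the maps induced by the projections, is the
    colimit. A cocone d determines dh on formal combinations of generators, by
    evaluating the generator s at the quotient by its kernel; dh vanishes on
    relations, so it descends to X(G). *)
Lemma central_stabilityP : central_stability X.
Proof.
have [m mP] := relations_bounded.
pose n := maxn m (\max_i #|G_ i|); exists n => G.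
have le_n i : (#|G_ i| <= n)%N.
  rewrite /n leq_max; apply/orP; right.
  exact: (leq_bigmax (F := fun i => #|G_ i|)).
have legsP (H H' : Nsub G n) (sHH' : val H \subset val H') (x : X (quot H')) :
    psh_map X (proj H) (psh_map X (proj2 sHH') x) = psh_map X (proj H') x.
  by rewrite -(comp_proj2 sHH') (@psh_map_comp k _ X G (quot H) (quot H')).
exists (X G), (Cocone legsP), idfun; split=> //; last by exists id.
move=> W d.
have fac (s : surjs G_ G) := kernel_factor (tagged s) (le_n (tag s)).
pose Hs s := sval (constructive_indefinite_description _ (fac s)).
have HsP s : exists v : hom (quot (Hs s)) (G_ (tag s)),
    comp_hom v (proj (Hs s)) = tagged s /\ forall x, rep (tagged s) x = 1%g -> x \in val (Hs s).
  exact: (svalP (constructive_indefinite_description _ (fac s))).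
pose vs s := sval (constructive_indefinite_description _ (HsP s)).
have vsP s : comp_hom (vs s) (proj (Hs s)) = tagged s
    /\ forall x, rep (tagged s) x = 1%g -> x \in val (Hs s).
  exact: (svalP (constructive_indefinite_description _ (HsP s))).
pose D s := d (Hs s) (@psh_map k _ X (quot (Hs s)) (G_ (tag s)) (vs s) (x_ (tag s))).
pose dh (c : free_mod k (surjs G_ G)) : W := \sum_s (c s : k) *: D s.
have dhL : linear dh.
  move=> a c c'; rewrite /dh scaler_sumr -big_split; apply: eq_bigr => s _ /=.
  by rewrite !ffunE scalerDl scalerA.
pose dH : {linear free_mod k (surjs G_ G) -> W} := HB.pack dh (GRing.isLinear.Build k _ _ _ dh dhL).
have dh_basis s : dh (basis_elt k s) = D s.
  rewrite /dh (bigD1 s) //= big1 ?addr0 => [|t ts]; first by rewrite ffunE eqxx scale1r.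
  by rewrite ffunE (negPf ts) scale0r.
pose F (A : obj (Zfam p)) : {linear free_mod k (surjs G_ A) -> X A} :=
  HB.pack (@ev _ _ X I G_ x_ A) (GRing.isLinear.Build k _ _ _ _ (@ev_linear _ _ X I G_ x_ A)).
have dh0 c : ev x_ c = 0 -> dh c = 0.
  move=> c0; apply: (mP G c c0 (fun c => dh c = 0)) => [|a c1 c2 d1 d2|Q u e leQ e0].
  - exact: (linear0 dH).
  - by rewrite -[LHS]/(dH _) linearD linearZ /= d1 d2 scaler0 addr0.
  have [H [w [wu _]]] := kernel_factor u (leq_trans leQ (leq_maxl _ _) : (#|Q| <= n)%N).
  suff -> : dh (free_map (surjs_pb u) e) = d H (psh_map X w (F Q e)) by rewrite /= e0 !linear0.
  apply: (free_mod_ext (f := dH \o free_map _) (g := d H \o psh_map X w \o F Q)) => -[i f].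
  rewrite /= free_map_basis dh_basis ev_basis.
  set s := surjs_pb _ _; have [vsE vsK] := vsP s.
  rewrite -[psh_map X w _]/((psh_map X w \o psh_map X f) (x_ i)) -(@psh_map_comp k _ X (quot H) Q).
  symmetry; apply: (@cocone_indep n G (G_ i)); last by rewrite vsE.
  by rewrite vsE -comp_homA wu.
have cof (y : X G) := constructive_indefinite_description _ (x_span y).
pose h (y : X G) : W := dh (sval (cof y)).
have hE c : h (ev x_ c) = dh c.
  apply/eqP; rewrite -subr_eq0 /h -[_ - _](linearB dH); apply/eqP/dh0.
  by rewrite -[LHS]/(F G _) linearB /= (svalP (cof (ev x_ c))) subrr.
have hL : linear h.
  move=> a y y'; have [c <-] := x_span y; have [c' <-] := x_span y'.
  by rewrite -(ev_linear x_ a c c') !hE dhL.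
pose hl : {linear X G -> W} := HB.pack h (GRing.isLinear.Build k _ _ _ h hL).
exists hl; split=> [H x|h' h'P y].
  have [c <-] := x_span x.
  rewrite /= -(@ev_map G (quot H)) hE.
  apply: (free_mod_ext (f := dH \o free_map _) (g := d H \o F (quot H))) => -[i f].
  rewrite /= free_map_basis dh_basis ev_basis.
  set s := Tagged _ _; have [vsE vsK] := vsP s.
  by symmetry; apply: (@cocone_indep n G (G_ i)); rewrite vsE.
have [c <-] := x_span y; rewrite /= hE.
apply: (free_mod_ext (f := h' \o F G) (g := dH)) => s.
rewrite /= dh_basis; have [vsE _] := vsP s.
rewrite -[LHS]/(h' (ev x_ (basis_elt k s))).
case: s vsE => i f vsE.
rewrite ev_basis -[f in LHS]vsE (@psh_map_comp k _ X G (quot (Hs (existT _ i f)))) /=.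
exact: h'P.
Qed.

End Applications.

(** * Cyclic groups *)

Section Cyclic.
Local Open Scope group_scope.
Variables (p : nat) (p_pr : prime p).
Implicit Types (A B C : obj (Cfam p)) (G : obj (Zfam p)).

Lemma cyclic_gen A : exists a : A, basis [:: a] [set: A]%G /\ #[a] = #|A|.
Proof.
have /andP[_ /cyclicP[a defA]] := obj_in A; exists a.
by rewrite /basis big_seq1 /= defA orderE -defA cardsT.
Qed.

Lemma abelianC A : abelian [set: A].
Proof. by have /Cfam_Zfam/andP[] := obj_in A. Qed.

Lemma pgroupC A : p.-group [set: A].
Proof. by have /andP[] := obj_in A. Qed.

Lemma pgroupZ G : p.-group [set: G].
Proof. by have /andP[] := obj_in G. Qed.

Lemma order_le (A : finGroupType) (x : A) : #[x] <= #|A|.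
Proof. by rewrite orderE -cardsT subset_leq_card ?subsetT. Qed.

Lemma hom_of_gen (B A : finGroupType) (b : B) (q : A) :
    p.-group [set: B] -> p.-group [set: A] -> abelian [set: A] ->
    basis [:: b] [set: B]%G -> generates [:: q] -> #[q] <= #[b] ->
  exists u : hom B A, rep u b = q.
Proof.
move=> pB pA cA bB gq le_qb.
have [|u] := hom_of_basis cA bB gq (erefl _); last by case=> <-; exists u.
by case=> //= _; apply: (order_dvd p_pr).
Qed.

Lemma cyclic_factor G A B (f : hom B G) : #|G| <= #|A| <= #|B| ->
  exists (g : hom A G) (u : hom B A), f = comp_hom g u.
Proof.
case/andP=> leGA leAB; have [a [bA oa]] := cyclic_gen A; have [b [bB ob]] := cyclic_gen B.
have [u ub] : exists u : hom B A, rep u b = a.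
  by apply: hom_of_gen; rewrite ?pgroupC ?abelianC ?ob ?oa //; exact: basis_generates.
have [g ga] : exists g : hom A G, rep g a = rep f b.
  apply: hom_of_gen; rewrite ?pgroupC ?pgroupZ ?abelianZ ?oa //.
    exact: (generates_map (b := [:: b])) (basis_generates bB).
  exact: leq_trans (order_le _) leGA.
exists g, u; apply: hom_ext (basis_generates bB) _ => x; rewrite inE => /eqP->.
by rewrite rep_comp ?ub ?ga //; exact: abelianZ.
Qed.

(** A lift y to B of the image of a generator of C generates B: subgroups of a
    cyclic p-group are totally ordered, so the subgroup generated by y contains
    the kernel of v unless it is contained in it, which would make A trivial. *)
Lemma cyclic_lift A B (v : hom B A) C (f : hom C A) : 1 < #|A| -> #|B| <= #|C| ->
  exists g : hom C B, f = comp_hom v g.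
Proof.
move=> gtA leBC; have [c [bC oc]] := cyclic_gen C; have gc := basis_generates bC.
have gfc : generates [:: rep f c] := generates_map gc.
have [y vy] := rep_onto v (rep f c).
have [g gE] : exists g : hom C B, rep g c = y.
  apply: hom_of_gen; rewrite ?pgroupC ?abelianC //; last first.
    by rewrite oc; apply: leq_trans (order_le _) leBC.
  move=> K yK; have {}yK : y \in K by apply: yK; rewrite inE.
  have [cycB pB] : cyclic [set: B] /\ p.-group [set: B].
    by have /andP[] := obj_in B.
  have [sKk|skK] : K \subset 'ker (rep_morphism v) \/ 'ker (rep_morphism v) \subset K.
    rewrite -(cardSg_cyclic cycB) ?subsetT // -(cardSg_cyclic cycB) ?subsetT //.
    have pK := pgroupS (subsetT K) pB; have pk := pgroupS (subsetT ('ker (rep_morphism v))) pB.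
    by case/orP: (leq_total #|K| #|'ker (rep_morphism v)|) => le; [left|right];
      apply: (pnat_dvdn p_pr).
  - have fc1 : rep f c = 1 by rewrite -vy; apply/eqP; have:= subsetP sKk y yK; rewrite !inE.
    have : #|A| <= 1; last by rewrite leqNgt gtA.
    rewrite -cardsT -(cards1 (1 : A)); apply/subset_leq_card/subsetP => z _.
    by apply: (gfc 1%G) => t; rewrite inE fc1 => /eqP->; apply: group1.
  - apply: (generates_lift (v := v) gfc) => [x vx|t].
      by apply: (subsetP skK); rewrite !inE /= vx.
    by rewrite inE => /eqP->; exists y.
exists g; apply: hom_ext gc _ => x; rewrite inE => /eqP->.
by rewrite rep_comp ?gE ?vy //; exact: abelianC.
Qed.

End Cyclic.

(** * Free modules over Z/p^n *)

Section Free.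
Local Open Scope group_scope.
Variables (p : nat) (p_pr : prime p) (n : nat).
Implicit Types gT Q : finGroupType.

(** A numerical characterization of (Z/p^(n+1))^r: the subgroup of p^n-th powers
    has order p^r. A lower bound suffices: together with the other
    conditions it yields elements of order p^(n+1), and it passes to complements
    of the cyclic subgroups that they generate. *)
Record free_of_rank gT r (H : {group gT}) : Prop := FreeOfRank {
  free_abelian : abelian H;
  free_exp : forall x, x \in H -> x ^+ (p ^ n.+1) = 1;
  free_card : #|H| = (p ^ (n.+1 * r))%N;
  free_Mho : p ^ r <= #|'Mho^n(H)| }.

Lemma free_pgroup gT r (H : {group gT}) : free_of_rank r H -> p.-group H.
Proof. by move=> fH; rewrite /pgroup (free_card fH) pnatX pnat_id. Qed.

(** Otherwise K, of index at most p^r, is contained in the p^n-torsion of H, whose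
    index is the order of the subgroup of p^n-th powers, at least p^(r+1). *)
Lemma full_order gT r (H : {group gT}) (K : {group gT}) :
    free_of_rank r.+1 H -> K \subset H -> #|H| <= #|K| * p ^ r ->
  exists2 v, v \in K & #[v] = (p ^ n.+1)%N.
Proof.
move=> fH sKH leH; apply: NNPP => no; have pH := free_pgroup fH.
have sK : K \subset 'Ohm_n(H).
  apply/subsetP => x xK; have xH := subsetP sKH x xK.
  rewrite (OhmE n pH) mem_gen // inE xH inE -order_dvdn.
  have : #[x] %| p ^ n.+1 by rewrite order_dvdn (free_exp fH).
  case/(dvdn_pfactor _ _ p_pr) => m; rewrite leq_eqVlt => /orP[/eqP->|] ox.
    by case: no; exists x.
  by move=> ->; apply: dvdn_exp2l.
move: leH; rewrite -(mul_card_Ohm_Mho_abelian n (free_abelian fH)).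
apply/negP; rewrite -ltnNge; apply: (@leq_ltn_trans (#|'Ohm_n(H)| * p ^ r)).
  by rewrite leq_mul2r subset_leq_card ?orbT.
rewrite ltn_pmul2l ?cardG_gt0 //; apply: leq_trans (free_Mho fH).
by rewrite ltn_exp2l ?prime_gt1.
Qed.

Lemma free_split gT r (H : {group gT}) v :
    free_of_rank r.+1 H -> v \in H -> #[v] = (p ^ n.+1)%N ->
  exists2 C : {group gT}, free_of_rank r C & <[v]> \x C = H.
Proof.
move=> fH vH ov; have pH := free_pgroup fH.
have ex : #[v] = exponent H.
  apply/eqP; rewrite eqn_dvd dvdn_exponent //=; apply/exponentP => x.
  by rewrite ov; exact: (free_exp fH).
case/splitsP: (abelian_splits vH ex (free_abelian fH)) => C /complP[tiC defH].
have sCH : C \subset H by rewrite -defH mulG_subr.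
have sVH : <[v]> \subset H by rewrite cycle_subG.
have dH : <[v]> \x C = H.
  by rewrite dprodE //; apply: sub_abelian_cent2 (free_abelian fH) _ _.
exists C => //; split.
- exact: abelianS sCH (free_abelian fH).
- by move=> x /(subsetP sCH); exact: (free_exp fH).
- have := dprod_card dH; rewrite -orderE ov (free_card fH) mulnS expnD.
  by move/eqP; rewrite eqn_pmul2l ?expn_gt0 ?prime_gt0 // => /eqP.
have := free_Mho fH; rewrite -(dprod_card (Mho_dprod n dH)).
rewrite (Mho_p_cycle n (mem_p_elt pH vH)) -orderE orderXdiv ov; last first.
  by rewrite dvdn_exp2l.
have -> : (p ^ n.+1 %/ p ^ n)%N = p by rewrite expnS mulnK ?expn_gt0 ?prime_gt0.
by rewrite expnS leq_pmul2l ?prime_gt0.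
Qed.

(** While the rank exceeds s, the kernel of f has index at most p^s, so it is
    too large to avoid all elements of order p^(n+1). Such an element splits off, and the
    construction continues in a complement. *)
Lemma adapted_basis gT Q (f : {morphism [set: gT] >-> Q}) s r (H : {group gT}) :
    #|Q| <= p ^ s -> free_of_rank r H ->
  exists b : seq gT, [/\ basis b H, size b = r, forall x, x \in b -> #[x] = (p ^ n.+1)%N
    & forall i, s <= i < r -> f (nth 1 b i) = 1].
Proof.
move=> leQ; elim: r H => [|r IH] H fH.
  exists [::]; split=> //; last by move=> i; rewrite ltn0 andbF.
  rewrite /basis big_nil; apply/esym/card1_trivg.
  by rewrite (free_card fH) muln0.
have [K [sKH leH fK]] : exists K : {group gT}, [/\ K \subset H, #|H| <= #|K| * p ^ r
    & s <= r -> forall x, x \in K -> f x = 1].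
  have [le_sr|lt_rs] := leqP s r; last first.
    by exists H; split=> //; rewrite leq_pmulr ?expn_gt0 ?prime_gt0.
  exists (H :&: 'ker f)%G; split=> [||_ x]; first exact: subsetIl.
    apply: (@leq_trans (#|H :&: 'ker f| * #|f @* H|)).
      by rewrite card_morphim (setIidPr (subsetT H)) -indexgI Lagrange ?subsetIl.
    rewrite leq_mul2l; apply/orP; right; apply: leq_trans (_ : p ^ s <= _); last first.
      by rewrite leq_exp2l ?prime_gt1.
    by apply: leq_trans leQ; rewrite -cardsT subset_leq_card ?subsetT.
  by rewrite inE => /andP[_ /mker].
have [v vK ov] := full_order fH sKH leH.
have [C fC dC] := free_split fH (subsetP sKH v vK) ov.
have [b [bC sz ob fb]] := IH C fC.
exists (rcons b v); split.
- by rewrite /basis (perm_big (v :: b)) /= ?perm_rcons // big_cons bC.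
- by rewrite size_rcons sz.
- by move=> x; rewrite mem_rcons inE => /orP[/eqP->|/ob].
- move=> i /andP[le_si]; rewrite ltnS leq_eqVlt => /orP[/eqP ir|lt_i].
    by rewrite nth_rcons ir sz ltnn eqxx fK -?ir.
  by rewrite nth_rcons sz lt_i fb ?le_si.
Qed.

Lemma free_isog gT hT r (G : {group gT}) (H : {group hT}) :
  G \isog H -> free_of_rank r H -> free_of_rank r G.
Proof.
move=> iGH fH; split.
- by rewrite (isog_abelian iGH) (free_abelian fH).
- move=> x xG; apply/(exponentP (A := G)) => //.
  by rewrite (exponent_isog iGH); apply/exponentP; exact: (free_exp fH).
- by rewrite (card_isog iGH) (free_card fH).
- by rewrite (card_isog (isog_Mho n iGH)) (free_Mho fH).
Qed.

Lemma free_rV r : free_of_rank r [set: 'rV['Z_(p ^ n.+1)]_r]%G.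
Proof.
have q_gt1 : 1 < p ^ n.+1 by rewrite -(exp1n n.+1) ltn_exp2r ?prime_gt1.
have q0 : ((p ^ n.+1)%:R = 0 :> 'Z_(p ^ n.+1))%R.
  by apply: val_inj; rewrite /= val_Zp_nat // modnn.
have cH : #|[set: 'rV['Z_(p ^ n.+1)]_r]%G| = (p ^ (n.+1 * r))%N.
  by rewrite cardsT card_mx card_ord Zp_cast // mul1n expnM.
have pH : p.-group [set: 'rV['Z_(p ^ n.+1)]_r]%G.
  by rewrite /pgroup cH pnatX pnat_id.
split=> //; first exact: FinRing.zmod_abelian.
  move=> x _; rewrite FinRing.zmodXgE -scaler_nat.
  by rewrite q0 scale0r.
rewrite (MhoEabelian n pH (FinRing.zmod_abelian _)).
pose g (w : {ffun 'I_r -> 'I_p}) : 'rV['Z_(p ^ n.+1)]_r := (\row_j (w j * p ^ n)%:R)%R.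
have gI : injective g.
  move=> w w' /rowP ww'; apply/ffunP => j; apply: val_inj.
  have lt_q (i : 'I_p) : i * p ^ n < p ^ n.+1 by rewrite expnS ltn_pmul2r ?expn_gt0 ?prime_gt0.
  have /(congr1 val) := ww' j; rewrite !mxE /= !val_Zp_nat // !modn_small //.
  by move/eqP; rewrite eqn_pmul2r ?expn_gt0 ?prime_gt0 // => /eqP.
(* Counts the p^n-th powers from below by the vectors p^n w with 0 <= w_j < p. *)
have -> : (p ^ r)%N = #|[set g w | w : {ffun 'I_r -> 'I_p}]|.
  by rewrite card_imset // card_ffun !card_ord.
apply/subset_leq_card/subsetP => _ /imsetP[w _ ->]; apply/imsetP.
exists (\row_j (w j)%:R)%R; rewrite ?inE // FinRing.zmodXgE.
by apply/rowP => j; rewrite mulmxnE !mxE -mulrnA.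
Qed.

End Free.

Section FreeObjects.
Local Open Scope group_scope.
Variables (p : nat) (p_pr : prime p) (n : nat).
Implicit Types (A B C : obj (Ffam p n.+1)) (G : obj (Zfam p)).

Lemma free_obj A : exists r, free_of_rank p n r [set: A]%G.
Proof.
have [r iA] := obj_in A; exists r; exact: free_isog iA (free_rV p_pr n r).
Qed.

Lemma abelianF A : abelian [set: A].
Proof. by have [r /free_abelian] := free_obj A. Qed.

Lemma order_free r A (x : A) : free_of_rank p n r [set: A]%G -> #[x] %| p ^ n.+1.
Proof. by move=> fA; rewrite order_dvdn (free_exp fA) ?inE. Qed.

Lemma leq_expn_self m : m <= p ^ m.
Proof. exact: ltnW (ltn_expl m (prime_gt1 p_pr)). Qed.

(** Take a basis of B all of whose members from the s-th on are killed by f, where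
    s is the rank of A; send its first s members to a basis of A and the others
    to 1. *)
Lemma free_factor G A B (f : hom B G) :
    #|G| ^ n.+1 <= #|A| <= #|B| ->
  exists (g : hom A G) (u : hom B A), f = comp_hom g u.
Proof.
have [s fA] := free_obj A; have [r fB] := free_obj B.
have cA : #|A| = (p ^ (n.+1 * s))%N by rewrite -(free_card fA) cardsT.
have cB : #|B| = (p ^ (n.+1 * r))%N by rewrite -(free_card fB) cardsT.
case/andP; rewrite {1}cA mulnC expnM leq_exp2r // => leG.
rewrite cA cB leq_exp2l ?prime_gt1 // leq_pmul2l // => le_sr.
have [b [bB sb ob fb]] := adapted_basis p_pr (rep_morphism f) leG fB.
have {}fb i : s <= i < r -> rep f (nth 1 b i) = 1 := fb i.
have [a [aA sa oa _]] :=
  adapted_basis p_pr (rep_morphism (id_hom A)) (leq_expn_self #|A|) fA.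
have gb := basis_generates bB; have ga := basis_generates aA.
have [|||u ub] := hom_of_basis (q := a ++ nseq (r - s) 1) (abelianF A) bB.
- by move=> K qK; apply: ga => x xa; apply: qK; rewrite mem_cat xa.
- by rewrite size_cat size_nseq sa sb subnKC.
- by move=> i lt_i; rewrite (ob (nth 1 b i)) ?mem_nth // (order_free _ fA).
have [|||g gE] := hom_of_basis (q := take s (map (rep f) b)) (abelianZ G) aA.
- move=> K qK; apply: (generates_map (u := f) gb) => x /(nthP 1)[i].
  rewrite size_map sb => lt_i <-; have [lt_is|le_si] := ltnP i s.
    by apply: qK; rewrite -(nth_take 1 lt_is) mem_nth // size_takel ?size_map ?sb.
  by rewrite (nth_map 1) ?sb // fb ?le_si ?group1.
- by rewrite sa size_takel // size_map sb.
- move=> i lt_i; rewrite (oa (nth 1 a i)) ?mem_nth // nth_take -?sa //.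
  rewrite (nth_map 1) ?sb ?(leq_trans lt_i) ?sa // order_dvdn.
  have := free_exp fB (in_setT (nth 1 b i)).
  move/(congr1 (rep_morphism f)); rewrite morphX ?inE // morph1 /= => ->.
  exact: eqxx.
exists g, u; apply: hom_ext gb _ => x xb.
rewrite rep_comp; last exact: abelianZ.
case/(nthP 1): xb => i; rewrite sb => lt_i <-.
rewrite -(nth_map 1 1) ?sb // -[in RHS](nth_map 1 1 (rep u)) ?sb // ub nth_cat sa.
case: ltnP => [lt_is|le_si].
  by rewrite -(nth_take 1 lt_is) -gE (nth_map 1) ?sa.
by rewrite nth_nseq if_same rep1 (nth_map 1) ?sb // fb // le_si.
Qed.

(** In a basis of C adapted to f, lift the images of the first |A| members to B. The
    following members are killed by f, so they may be sent to all the elements of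
    the kernel of v, which makes the lift of f to B surjective. *)
Lemma free_lift A B (v : hom B A) C (f : hom C A) :
    p ^ (n.+1 * (#|A| + #|B|)) <= #|C| ->
  exists g : hom C B, f = comp_hom v g.
Proof.
have [r fC] := free_obj C; have [t fB] := free_obj B.
have cC : #|C| = (p ^ (n.+1 * r))%N by rewrite -(free_card fC) cardsT.
rewrite cC leq_exp2l ?prime_gt1 // leq_pmul2l // => le_r.
have [c [cC' sc oc fc]] := adapted_basis p_pr (rep_morphism f) (leq_expn_self #|A|) fC.
have {}fc i : #|A| <= i < r -> rep f (nth 1 c i) = 1 := fc i.
have gc := basis_generates cC'.
pose lift (y : A) : B := odflt 1 [pick x | rep v x == y].
have liftP y : rep v (lift y) = y.
  rewrite /lift; case: pickP => [x /eqP //|no].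
  by have [x vx] := rep_onto v y; have := no x; rewrite vx eqxx.
pose ker := [seq x <- enum B | rep v x == 1].
have le_ker : size ker <= #|B| by rewrite size_filter cardE count_size.
pose q := map lift (take #|A| (map (rep f) c)) ++ ker ++ nseq (r - #|A| - size ker) 1.
have s1 : size (map lift (take #|A| (map (rep f) c))) = #|A|.
  by rewrite size_map size_takel // size_map sc (leq_trans _ le_r) ?leq_addr.
have sq : size q = r.
  rewrite /q !size_cat size_nseq s1 [in LHS]subnKC ?subnKC //.
    by rewrite (leq_trans _ le_r) ?leq_addr.
  by rewrite leq_subRL ?(leq_trans _ le_r) ?leq_addr ?leq_add2l.
have vq i : i < r -> rep v (nth 1 q i) = rep f (nth 1 c i).
  move=> lt_i; rewrite /q nth_cat s1; case: ltnP => [lt_iA|le_Ai].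
    have lt_i' : i < size (take #|A| (map (rep f) c)) by rewrite -(size_map lift) s1.
    by rewrite (nth_map 1) // liftP nth_take // (nth_map 1) ?sc.
  have -> : rep f (nth 1 c i) = 1 by apply: fc; rewrite le_Ai.
  rewrite nth_cat; case: ltnP => [lt_k|_]; last by rewrite nth_nseq if_same rep1.
  by have := mem_nth 1 lt_k; rewrite mem_filter => /andP[/eqP].
have [|||g gE] := hom_of_basis (q := q) (abelianF B) cC'.
- move=> K qK; apply: (generates_lift (v := v) (generates_map (u := f) gc)) => [x vx|y].
    by apply: qK; rewrite /q !mem_cat mem_filter vx eqxx mem_enum orbT.
  case/(nthP 1)=> i; rewrite size_map sc => lt_i; rewrite (nth_map 1) ?sc // => <-.
  by exists (nth 1 q i); [apply/qK/mem_nth; rewrite sq | exact: vq].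
- by rewrite sq sc.
- by move=> i lt_i; rewrite (oc (nth 1 c i)) ?mem_nth // (order_free _ fB).
exists g; apply: hom_ext gc _ => x xc; rewrite rep_comp; last exact: abelianF.
case/(nthP 1): xc => i; rewrite sc => lt_i <-.
by rewrite -[in RHS](nth_map 1 1 (rep g)) ?sc // gE vq.
Qed.

End FreeObjects.

Theorem theorem2 (k : fieldType) (k_char0 : ([pchar k] =i pred0)%R)
    (p : nat) (p_pr : prime p)
    (X : presheaf k (Zfam p)) (X_fg : finitely_generated X) :
  (generated_in_finite_degree (restrict (@Cfam_Zfam p) X) /\
   eventually_torsion_free (restrict (@Cfam_Zfam p) X)) /\
  (forall (n : nat) (n_gt0 : 0 < n),
     generated_in_finite_degree (restrict (Ffam_Zfam p_pr n_gt0) X) /\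
     eventually_torsion_free (restrict (Ffam_Zfam p_pr n_gt0) X)) /\
  central_stability X.
Proof.
have [I [G_ [x_ x_span]]] := fg_spanned X_fg.
pose r := \max_i #|G_ i|.
have le_r i : #|G_ i| <= r by exact: (leq_bigmax (F := fun i => #|G_ i|)).
split; [split | split].
- apply: (generated_in_finite_degreeP x_span _ (r := r)) => i A B f /andP[leA leB].
  by apply: cyclic_factor => //; rewrite (leq_trans (le_r i) leA).
- apply: (eventually_torsion_freeP p_pr x_span _ (r := 2)) => A B v gtA.
  by exists #|B| => C f; apply: cyclic_lift.
- case=> // n n_gt0; split.
    apply: (generated_in_finite_degreeP x_span _ (r := r ^ n.+1)) => i A B f /andP[leA leB].
    apply: (free_factor p_pr); rewrite leB andbT; apply: leq_trans leA.
    by rewrite leq_exp2r.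
  apply: (eventually_torsion_freeP p_pr x_span _ (r := 0)) => A B v _.
  by exists (p ^ (n.+1 * (#|A| + #|B|)))%N => C f; apply: free_lift.
exact: (central_stabilityP p_pr x_span).
Qed.
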